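(* Let $S$ be a Polish space and $\mu_0,\mu_0^{(1)},\mu_0^{(2)},\dots$ diffuse probability measures on $S$ with $\mu_0^{(n)}\to\mu_0$ weakly as $n\to\infty$. For $n\ge1$ let $\rho^{(n)}\in(0,1)$ and let $(\mathbf{x}^{(n)}_i)_{i\ge1}$ be conditionally i.i.d. given $\boldsymbol{\mu}^{(n)}$ with law $\boldsymbol{\mu}^{(n)}$, where $\boldsymbol{\mu}^{(n)}$ is a species sampling process with base measure $\mu_0^{(n)}$ and tie probability $\rho^{(n)}$. (i) If $\rho^{(n)}\to0$, then $\boldsymbol{\mu}^{(n)}$ converges weakly in distribution to $\mu_0$, and $(\mathbf{x}^{(n)}_i)_{i\ge1}$ converges in distribution to an i.i.d. sequence $(\mathbf{x}_i)_{i\ge1}$ with $\mathbf{x}_i\sim\mu_0$. (ii) If $\rho^{(n)}\to1$, then $\boldsymbol{\mu}^{(n)}$ converges weakly in distribution to $\delta_{\mathbf{x}}$ with $\mathbf{x}\sim\mu_0$, and $(\mathbf{x}^{(n)}_i)_{i\ge1}$ converges in distribution to the constant sequence $(\mathbf{x},\mathbf{x},\dots)$.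
   Context: A species sampling process on $S$ with base measure $\lambda_0$ (diffuse probability measure) is a random probability measure $\sum_{j\ge1}\mathbf{w}_j\delta_{\boldsymbol{\xi}_j}+(1-\sum_j\mathbf{w}_j)\lambda_0$ with $\mathbf{w}_j\ge0$, $\sum_j\mathbf{w}_j\le1$ a.s., independent of i.i.d. atoms $\boldsymbol{\xi}_j\sim\lambda_0$; its tie probability is $\sum_j\mathbb{E}[\mathbf{w}_j^2]=\mathbb{P}[\mathbf{x}_1=\mathbf{x}_2]$ for $\mathbf{x}_1,\mathbf{x}_2$ conditionally i.i.d. from it. Random probability measures $\boldsymbol{\mu}^{(n)}$ converge weakly in distribution to $\boldsymbol{\mu}$ if $\int f\,d\boldsymbol{\mu}^{(n)}\to\int f\,d\boldsymbol{\mu}$ in distribution for every bounded continuous $f:S\to\mathbb{R}$. Convergence in distribution of sequences is in $S^\infty$ with the product topology. *)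

(* Defs.v *)
From HB Require Import structures.
From mathcomp Require Import all_boot all_order all_algebra.
From mathcomp Require Import all_classical all_reals all_analysis.

Set Implicit Arguments.
Unset Strict Implicit.
Unset Printing Implicit Defensive.

Import Order.TTheory GRing.Theory Num.Theory.
Import numFieldTopology.Exports numFieldNormedType.Exports.

Local Open Scope classical_set_scope.
Local Open Scope ring_scope.

Section Defs.
Context {R : realType}.

(** Polish space: a (chosen) complete metric, Hausdorff (so metric, not only
    pseudometric), separable (countable dense subset). *)
Definition polish (S : completePseudoMetricType R) : Prop :=
  hausdorff_space S /\ exists D : set S, countable D /\ dense D.

Definition borel (S : ptopologicalType) : measurableType (sigma_display (@open S)) :=
  g_sigma_algebraType (@open S).

Definition bounded_continuous {T : topologicalType} (f : T -> R) : Prop :=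
  continuous f /\ exists M : R, forall x, `|f x| <= M.

Definition diffuse {d} {T : measurableType d} (mu : set T -> \bar R) : Prop :=
  forall x : T, mu [set x] = 0%E.

Definition weak_cvg {S : ptopologicalType} (mun : nat -> probability (borel S) R)
  (mu : probability (borel S) R) : Prop :=
  forall f : S -> R, bounded_continuous f ->
    (\int[mun n]_x f x) @[n --> \oo] --> \int[mu]_x f x.

Definition sigma_of {dO} {Om : measurableType dO} {d'} {T : measurableType d'}
  (X : nat -> Om -> T) : set (set Om) :=
  <<s \bigcup_(j in [set: nat]) [set X j @^-1` E | E in measurable] >>.

Definition species_sampling {dO} {Om : measurableType dO} (P : probability Om R)
  {S : ptopologicalType} (lambda0 : probability (borel S) R) (rho : R)
  (mu : Om -> probability (borel S) R) : Prop :=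
  measurable_fun [set: Om] (mu : Om -> pprobability (borel S) R) /\
  exists (w : nat -> Om -> R) (xi : nat -> Om -> borel S),
    [/\ (forall j, measurable_fun [set: Om] (w j)),
        (forall j, measurable_fun [set: Om] (xi j)),
        (* (xi_j) i.i.d. lambda0 and independent of sigma(w_j : j) *)
        (forall B : set Om, sigma_of w B ->
           forall (k : nat) (A : nat -> set (borel S)),
             (forall j, measurable (A j)) ->
             P (B `&` \bigcap_(j in `I_k) (xi j @^-1` A j)) =
               (P B * \prod_(j < k) lambda0 (A j))%E),
        {ae P, forall om,
           [/\ (forall j, 0 <= w j om),
               (\sum_(j <oo) (w j om)%:E <= 1)%E &
               forall A : set (borel S), measurable A ->
                 mu om A = (\sum_(j <oo) ((w j om)%:E * \d_(xi j om) A)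
                            + (1%:E - \sum_(j <oo) (w j om)%:E) * lambda0 A)%E]}
      & (\sum_(j <oo) (\int[P]_om ((w j om) ^+ 2)%:E))%E = rho%:E].

Definition cond_iid {dO} {Om : measurableType dO} (P : probability Om R)
  {S : ptopologicalType} (mu : Om -> probability (borel S) R)
  (x : nat -> Om -> borel S) : Prop :=
  (forall i, measurable_fun [set: Om] (x i)) /\
  forall (C : set (pprobability (borel S) R)), measurable C ->
  forall (k : nat) (A : nat -> set (borel S)), (forall i, measurable (A i)) ->
    P ((mu @^-1` C) `&` \bigcap_(i in `I_k) (x i @^-1` A i)) =
      (\int[P]_(om in mu @^-1` C) \prod_(i < k) mu om (A i))%E.

Definition iid {dO} {Om : measurableType dO} (P : probability Om R)
  {S : ptopologicalType} (lambda0 : probability (borel S) R)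
  (y : nat -> Om -> borel S) : Prop :=
  (forall i, measurable_fun [set: Om] (y i)) /\
  forall (k : nat) (A : nat -> set (borel S)), (forall i, measurable (A i)) ->
    P (\bigcap_(i in `I_k) (y i @^-1` A i)) = (\prod_(i < k) lambda0 (A i))%E.

Definition cvg_dist {T : topologicalType} {dO : nat -> measure_display}
  {Om : forall n, measurableType (dO n)} (P : forall n, probability (Om n) R)
  (X : forall n, Om n -> T)
  {d'} {Om' : measurableType d'} (Q : probability Om' R) (Y : Om' -> T) : Prop :=
  forall F : T -> R, bounded_continuous F ->
    (\int[P n]_om F (X n om)) @[n --> \oo] --> \int[Q]_om F (Y om).

Definition weak_cvg_dist {S : ptopologicalType} {dO : nat -> measure_display}
  {Om : forall n, measurableType (dO n)} (P : forall n, probability (Om n) R)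
  (mu : forall n, Om n -> probability (borel S) R)
  {d'} {Om' : measurableType d'} (Q : probability Om' R)
  (M : Om' -> probability (borel S) R) : Prop :=
  forall f : S -> R, bounded_continuous f ->
    @cvg_dist R^o dO Om P (fun n om => \int[mu n om]_x f x) d' Om' Q
      (fun om => \int[M om]_x f x).

End Defs.

(* Main.v *)
Require Import Defs.
From HB Require Import structures.
From mathcomp Require Import all_boot all_order all_algebra.
From mathcomp Require Import all_classical all_reals all_analysis.
From mathcomp Require Import measurable_realfun ring lra.
Import Order.TTheory GRing.Theory Num.Theory.
Import numFieldTopology.Exports numFieldNormedType.Exports.
Local Open Scope classical_set_scope.
Local Open Scope ring_scope.

(* Centering f at its base mean m_n = lambda_n(f) writes mu_n(f) - m_n as the
   orthogonal series sum_j w_j (f(xi_j) - m_n), whence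
   E (mu_n(f) - m_n)^2 = rho_n Var(f) and E mu_n((f - mu_n(f))^2) =
   (1 - rho_n) Var(f), variances being taken under lambda_n.  If rho_n -> 0, the
   first identity makes mu_n(f) concentrate at its mean; if rho_n -> 1, the second
   one makes mu_n degenerate, so that F(mu_n(f)) is close to mu_n(F o f), whose mean
   is lambda_n(F o f).  The same estimates give the limit of
   E prod_i mu_n(f_i) = E prod_i f_i(x_i).

   To pass from these product moments to convergence in S^oo without tightness,
   note that the indicator of an open G is a pointwise limit of functions
   1 - prod_l (1 - phi_l) <= 1_G, where the phi_l are products of continuous
   functions of single coordinates; expanding the product gives
   liminf P(x^(n) in G) >= P(x in G), and a layer cake sum turns this into
   convergence of E F(x^(n)) for bounded continuous F. *)

Set Implicit Arguments.
Unset Strict Implicit.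
Unset Printing Implicit Defensive.

(** * Bounded measurable functions *)

Section BoundedMeasurable.
Context {R : realType}.

(** Independence and conditional i.i.d. laws are given on rectangles of measurable sets, while the
    moment computations need bounded functions. The bridge is that a sup-norm bounded linear
    functional is determined by its values on indicators, used one factor at a time; it stands in
    for product measures and conditional expectations. No sigma-algebra is fixed on [S^oo], so even
    the measurability of [F] composed with a random sequence has to be produced: it comes from the
    same cylinder approximations as the lower bound. The matching upper bound is the lower bound for
    [1 - H], where [H] is [F] rescaled into [[0, 1]]. The species sampling formula holds only almost
    surely, hence the truncated weights and the almost everywhere hypotheses in the limit
    theorems. *)

Definition bmeas {d} {T : measurableType d} (f : T -> R) : Prop :=
  measurable_fun [set: T] f /\ exists M : R, forall x, `|f x| <= M.

Lemma bmeas_ge0_bound {d} {T : measurableType d} (f : T -> R) :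
  bmeas f -> exists2 M : R, 0 <= M & forall x, `|f x| <= M.
Proof. by move=> [_ [M fM]]; exists M => //; exact: le_trans (fM point). Qed.

Section closure.
Context {d} {T : measurableType d}.
Implicit Types f g : T -> R.

Lemma bmeas_cst (c : R) : bmeas (fun _ : T => c).
Proof. by split; [exact: measurable_cst|exists `|c|]. Qed.

Lemma bmeasD f g : bmeas f -> bmeas g -> bmeas (fun x => f x + g x).
Proof.
move=> [mf [M fM]] [mg [N gN]]; split; first exact: measurable_funD.
exists (M + N) => x; exact: le_trans (ler_normD _ _) (lerD (fM x) (gN x)).
Qed.

Lemma bmeasM f g : bmeas f -> bmeas g -> bmeas (fun x => f x * g x).
Proof.
move=> [mf [M fM]] [mg [N gN]]; split; first exact: measurable_funM.
by exists (M * N) => x; rewrite normrM ler_pM.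
Qed.

Lemma bmeas_sqr f : bmeas f -> bmeas (fun x => f x ^+ 2).
Proof. by move=> bf; exact: bmeasM. Qed.

Lemma bmeasZ (c : R) f : bmeas f -> bmeas (fun x => c * f x).
Proof. exact/bmeasM/bmeas_cst. Qed.

Lemma bmeasN f : bmeas f -> bmeas (fun x => - f x).
Proof.
by move=> /(bmeasZ (-1)); under eq_fun do rewrite mulN1r.
Qed.

Lemma bmeasB f g : bmeas f -> bmeas g -> bmeas (fun x => f x - g x).
Proof. by move=> ? /bmeasN; exact: bmeasD. Qed.

Lemma bmeas_norm f : bmeas f -> bmeas (fun x => `|f x|).
Proof.
move=> [mf [M fM]]; split; first exact: measurableT_comp.
by exists M => x; rewrite normr_id.
Qed.

Lemma bmeas_indic (A : set T) : measurable A -> bmeas (\1_A : T -> R).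
Proof.
move=> mA; split; first exact: measurable_indic.
by exists 1 => x; rewrite indicE; case: (_ \in _); rewrite ?normr1 ?normr0.
Qed.

Lemma bmeas_sum I (r : seq I) (F : I -> T -> R) :
  (forall i, bmeas (F i)) -> bmeas (fun x => \sum_(i <- r) F i x).
Proof.
move=> bF; elim: r => [|i r IH].
  by under eq_fun do rewrite big_nil; exact: bmeas_cst.
by under eq_fun do rewrite big_cons; exact: bmeasD.
Qed.

Lemma bmeas_prod I (r : seq I) (F : I -> T -> R) :
  (forall i, bmeas (F i)) -> bmeas (fun x => \prod_(i <- r) F i x).
Proof.
move=> bF; elim: r => [|i r IH].
  by under eq_fun do rewrite big_nil; exact: bmeas_cst.
by under eq_fun do rewrite big_cons; exact: bmeasM.
Qed.

Lemma bmeas_comp {d'} {T' : measurableType d'} f (X : T' -> T) :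
  measurable_fun [set: T'] X -> bmeas f -> bmeas (fun x => f (X x)).
Proof.
move=> mX [mf [M fM]]; split; first exact: measurableT_comp.
by exists M.
Qed.

End closure.

Section expectation.
Context {d} {T : measurableType d} (P : probability T R).
Implicit Types f g : T -> R.

Lemma bmeas_integrable f : bmeas f -> P.-integrable [set: T] (EFin \o f).
Proof.
move=> [mf [M fM]]; apply: measurable_bounded_integrable => //.
  by rewrite (le_lt_trans (probability_le1 _ _)) ?ltry//.
by exists M; split; [exact: num_real|move=> N MN y _ /=; exact: le_trans (fM y) (ltW MN)].
Qed.

Lemma RexpD f g : bmeas f -> bmeas g ->
  \int[P]_x (f x + g x) = \int[P]_x f x + \int[P]_x g x.
Proof. by move=> bf bg; apply: RintegralD => //; exact: bmeas_integrable. Qed.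

Lemma RexpB f g : bmeas f -> bmeas g ->
  \int[P]_x (f x - g x) = \int[P]_x f x - \int[P]_x g x.
Proof. by move=> bf bg; apply: RintegralB => //; exact: bmeas_integrable. Qed.

Lemma RexpZ (c : R) f : bmeas f -> \int[P]_x (c * f x) = c * \int[P]_x f x.
Proof. by move=> bf; apply: RintegralZl => //; exact: bmeas_integrable. Qed.

Lemma Rexp_cst (c : R) : \int[P]_(_ in [set: T]) c = c.
Proof.
by rewrite Rintegral_cst//= probability_setT mulr1.
Qed.

Lemma le_Rexp f g : bmeas f -> bmeas g -> (forall x, f x <= g x) ->
  \int[P]_x f x <= \int[P]_x g x.
Proof. by move=> bf bg fg; apply: le_Rintegral => //; exact: bmeas_integrable. Qed.

Lemma Rexp_bound f (c : R) : bmeas f -> (forall x, `|f x| <= c) ->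
  `|\int[P]_x f x| <= c.
Proof.
move=> bf fc; apply: le_trans (le_normr_Rintegral _ (bmeas_integrable bf)) _ => //.
rewrite -[leRHS]Rexp_cst; apply: le_Rexp fc; first exact: bmeas_norm.
exact: bmeas_cst.
Qed.

Lemma Rexp_sum I (r : seq I) (F : I -> T -> R) : (forall i, bmeas (F i)) ->
  \int[P]_x (\sum_(i <- r) F i x) = \sum_(i <- r) \int[P]_x F i x.
Proof.
move=> bF; elim: r => [|i r IH].
  by rewrite big_nil; under eq_Rintegral do rewrite big_nil; rewrite Rexp_cst.
under eq_Rintegral do rewrite big_cons.
by rewrite RexpD ?IH ?big_cons//; exact: bmeas_sum.
Qed.

Lemma EFin_Rexp f : bmeas f -> (\int[P]_x f x)%:E = (\int[P]_x (f x)%:E)%E.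
Proof.
move=> bf; rewrite /Rintegral fineK//.
by apply: integrable_fin_num => //; exact: bmeas_integrable.
Qed.

Lemma Rexp_indic (A : set T) : measurable A -> \int[P]_x \1_A x = fine (P A).
Proof. by move=> mA; rewrite /Rintegral integral_indic// setIT. Qed.

Lemma Rexp_bounded_cvg (F : nat -> T -> R) f (c : R) :
  (forall n, bmeas (F n)) -> bmeas f -> {ae P, forall x n, `|F n x| <= c} ->
  {ae P, forall x, F n x @[n --> \oo] --> f x} ->
  \int[P]_x F n x @[n --> \oo] --> \int[P]_x f x.
Proof.
move=> bF bf Fc Ff.
have [|||||_ _] := @dominated_convergence _ T R P setT measurableT
  (fun n x => (F n x)%:E) (EFin \o f) (cst c%:E).
- by move=> n; apply/measurable_EFinP; case: (bF n).
- by apply/measurable_EFinP; case: bf.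
- by apply: filterS Ff => x Fx _; apply: cvg_EFin => //; exact: nearW.
- exact: (bmeas_integrable (bmeas_cst c)).
- by apply: filterS Fc => x Fx n _ /=; rewrite lee_fin.
by rewrite -EFin_Rexp// => /fine_cvg.
Qed.

End expectation.
End BoundedMeasurable.

(** * Extension from indicators to bounded functions *)

Section LayerCake.
Context {R : realType}.

(* Lower Riemann sum of the layer cake formula [t = \int_0^1 1_(s < t) ds]. *)
Definition layers (K : nat) (t : R) : R :=
  K%:R^-1 * \sum_(k < K) (k.+1%:R / K%:R < t)%R%:R.

(** The sum counts the integers of [[1, K]] strictly below [t]. If the last one is counted, the
    trivial bound by the number of terms is already below [t]. *)
Lemma sum_steps_le (K : nat) (t : R) : 0 <= t ->
  \sum_(k < K) (k.+1%:R < t)%R%:R <= t.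
Proof.
move=> t0; have leK (m : nat) : \sum_(k < m) (k.+1%:R < t)%R%:R <= (m%:R : R).
  elim: m => [|m IH]; first by rewrite big_ord0.
  by rewrite big_ord_recr/= -natr1 lerD// (ler_nat _ _ 1) leq_b1.
elim: K => [|K IH]; first by rewrite big_ord0.
rewrite big_ord_recr/=; have [Kt|_] := ltP; last by rewrite addr0.
by rewrite (le_trans _ (ltW Kt))// -natr1 lerD2r leK.
Qed.

Lemma ge_sum_steps (K : nat) (t : R) : t <= K%:R ->
  t <= \sum_(k < K) (k.+1%:R < t)%R%:R + 1.
Proof.
(* With [min t K.+1] in place of [t] the inequality holds for every [K], so the induction can drop
   the hypothesis [t <= K]. *)
move=> tK; rewrite -[leLHS](_ : Num.min t K.+1%:R = t); last first.
  by apply/min_idPl; rewrite (le_trans tK)// ler_nat.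
elim: K {tK} => [|K IH]; first by rewrite big_ord0 add0r ge_min lexx orbT.
rewrite big_ord_recr/=; have [Kt|tK] := ltP.
  rewrite addrAC; apply: le_trans (lerD IH (lexx 1)).
  by rewrite (min_idPr (ltW Kt)) natr1 ge_min lexx orbT.
rewrite addr0 (le_trans _ IH)// le_min !ge_min lexx/=.
by rewrite tK.
Qed.

Lemma layers_le (K : nat) (t : R) : 0 <= t -> layers K t <= t.
Proof.
(* For [K = 0] the inverse is 0 by convention and the whole expression vanishes. *)
case: K => [|K] t0; first by rewrite /layers invr0 mul0r.
rewrite /layers mulrC ler_pdivrMr ?ltr0Sn//.
under eq_bigr do rewrite ltr_pdivrMr ?ltr0Sn//.
by rewrite sum_steps_le// mulr_ge0.
Qed.

Lemma ge_layers (K : nat) (t : R) : (0 < K)%N -> t <= 1 ->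
  t <= layers K t + K%:R^-1.
Proof.
move=> K0 t1; have K0' : (0 : R) < K%:R by rewrite ltr0n.
rewrite /layers -[X in _ + X]mulr1 -mulrDr mulrC ler_pdivlMr//.
under eq_bigr do rewrite ltr_pdivrMr//.
by apply: ge_sum_steps; rewrite ler_piMl// ltW.
Qed.

End LayerCake.

Section Functionals.
Context {R : realType} {d} {T : measurableType d}.

(** A linear functional, continuous for the sup norm, on bounded measurable functions. Any bound [c]
    of [f] plays the role of the norm, so no supremum has to be formed. *)
Definition bfun (L : (T -> R) -> R) : Prop :=
  [/\ forall f g, bmeas f -> bmeas g -> L (fun x => f x + g x) = L f + L g,
      forall c f, bmeas f -> L (fun x => c * f x) = c * L f &
      exists C : R, forall f c, bmeas f -> (forall x, `|f x| <= c) ->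
        `|L f| <= C * c].

Section bfun_theory.
Variable L : (T -> R) -> R.
Hypothesis bL : bfun L.

Lemma bfunB f g : bmeas f -> bmeas g -> L (fun x => f x - g x) = L f - L g.
Proof.
move=> bf bg; have [LD LZ _] := bL.
rewrite -mulN1r -LZ// -LD//; last exact: bmeasZ.
by congr L; apply/funext => x; rewrite mulN1r.
Qed.

Lemma bfun_sum I (r : seq I) (F : I -> T -> R) : (forall i, bmeas (F i)) ->
  L (fun x => \sum_(i <- r) F i x) = \sum_(i <- r) L (F i).
Proof.
move=> bF; have [LD LZ _] := bL; elim: r => [|i r IH].
  have := LZ 0 _ (bmeas_cst 0); rewrite (mul0r (L _)) big_nil => L0; rewrite -[RHS]L0.
  by congr L; apply/funext => x; rewrite big_nil mulr0.
rewrite big_cons -IH -LD//; last exact: bmeas_sum.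
by congr L; apply/funext => x; rewrite big_cons.
Qed.

End bfun_theory.

Lemma bmeas_step (f : T -> R) (c : R) : bmeas f ->
  measurable [set x | c < f x].
Proof.
move=> [mf _]; have := mf measurableT `]c, +oo[%classic (measurable_itv _).
rewrite setTI; congr (measurable _); apply/seteqP; split => x /=.
  by rewrite in_itv/= andbT.
by rewrite in_itv/= andbT.
Qed.

Lemma step_indic (f : T -> R) (c : R) :
  (fun x => (c < f x)%R%:R) = \1_[set x | c < f x] :> (T -> R).
Proof.
apply/funext => x; rewrite indicE; congr (_%:R); congr nat_of_bool.
by apply/idP/idP => [h|]; rewrite ?inE.
Qed.

Lemma bmeas_layers (K : nat) (f : T -> R) : bmeas f ->
  bmeas (fun x => layers K (f x)).
Proof.
move=> bf; apply/bmeasZ/bmeas_sum => k; rewrite step_indic.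
exact/bmeas_indic/bmeas_step.
Qed.

Lemma bfun_layers L (K : nat) (f : T -> R) : bfun L -> bmeas f ->
  L (fun x => layers K (f x)) =
  K%:R^-1 * \sum_(k < K) L \1_[set x | k.+1%:R / K%:R < f x].
Proof.
move=> bL bf; have [_ LZ _] := bL.
have bs (k : 'I_K) : bmeas (fun x => (k.+1%:R / K%:R < f x)%R%:R : R).
  by rewrite step_indic; exact/bmeas_indic/bmeas_step.
rewrite /layers LZ ?bfun_sum//; last exact: bmeas_sum.
by under eq_bigr do rewrite step_indic.
Qed.

(** A function with values in [[0, 1]] is within [1/K] of its [layers K], a combination of
    indicators of level sets on which the functionals agree. The general case follows by an affine
    change of scale. *)
Lemma bfun_ext (L L' : (T -> R) -> R) : bfun L -> bfun L' ->
  (forall A, measurable A -> L \1_A = L' \1_A) ->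
  forall f, bmeas f -> L f = L' f.
Proof.
move=> bL bL' LL'.
have ext01 f : bmeas f -> (forall x, 0 <= f x <= 1) -> L f = L' f.
  move=> bf f01; apply/eqP; rewrite -subr_eq0 -normr_le0.
  have [_ _ [C LC]] := bL; have [_ _ [C' LC']] := bL'.
  apply/ler_addgt0Pr => e e0; rewrite add0r.
  (* Each functional moves by at most its constant times [1/K]; this [K] makes the two errors
     together at most [e]. *)
  have [K KC] : exists K : nat, (`|C| + `|C'|) / e < K.+1%:R.
    exists (Num.truncn ((`|C| + `|C'|) / e)).
    by rewrite truncnS_gt.
  pose g x := layers K.+1 (f x).
  have bg : bmeas g by exact: bmeas_layers.
  have fg x : `|f x - g x| <= K.+1%:R^-1.
    have /andP[f0 f1] := f01 x; rewrite ger0_norm ?subr_ge0 ?layers_le//.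
    by rewrite lerBlDl ge_layers.
  have LLg : L g = L' g.
    rewrite /g !bfun_layers//; congr (_ * _); apply: eq_bigr => k _.
    exact/LL'/bmeas_step.
  rewrite (_ : L f - L' f = (L f - L g) - (L' f - L' g)); last first.
    by rewrite LLg opprB addrA subrK.
  rewrite -!bfunB//; apply: le_trans (ler_normB _ _) _.
  have := LC _ _ (bmeasB bf bg) fg; have := LC' _ _ (bmeasB bf bg) fg.
  have K0 : (0 : R) < K.+1%:R by [].
  move=> h1 h2; apply: le_trans (lerD h2 h1) _.
  rewrite -mulrDl ler_pdivrMr//; move: KC; rewrite ltr_pdivrMr// => /ltW.
  by rewrite mulrC; apply: le_trans; rewrite lerD// ler_norm.
move=> f bf; have [M M0 fM] := bmeas_ge0_bound bf.
have [LD LZ _] := bL; have [LD' LZ' _] := bL'.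
(* [f + M] ranges over [[0, 2 * M]]; dividing by [2 * (M + 1)] keeps the factor invertible even when
   [M = 0]. *)
pose h x : R := (2 * (M + 1))^-1 * (f x + M).
have b1 : bmeas (fun x => f x + M) by exact/bmeasD/bmeas_cst.
have bh : bmeas h by exact: bmeasZ.
have M1 : 0 < 2 * (M + 1) by lra.
have h01 x : 0 <= h x <= 1.
  have /ler_normlP[? ?] := fM x.
  by rewrite /h mulrC divr_ge0/= ?ler_pdivrMr; lra.
have fE : f = (fun x => 2 * (M + 1) * h x - M * (fun=> 1) x).
  by apply/funext => x; rewrite /h mulrA divff ?gt_eqF// mul1r mulr1 addrK.
have b11 : bmeas (fun _ : T => 1 : R) by exact: bmeas_cst.
rewrite fE !bfunB; [|exact: bL'|exact: bmeasZ|exact: bmeasZ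
  |exact: bL|exact: bmeasZ|exact: bmeasZ].
rewrite (LZ _ h bh) (LZ _ _ b11) (LZ' _ h bh) (LZ' _ _ b11).
congr (_ * _ - _ * _); first exact: ext01.
by apply: ext01 => // x; rewrite ler01 lexx.
Qed.

End Functionals.

(** * Multilinear extension of product formulas *)

Section RandomMeans.
Context {R : realType} {d} {T : measurableType d}.
Context {dO} {Om : measurableType dO} (P : probability Om R).

(* Common shape of [f |-> f (X om)] and [f |-> \int[mu om] f]. *)
Definition random_mean (phi : Om -> (T -> R) -> R) : Prop :=
  [/\ forall om f g, bmeas f -> bmeas g ->
        phi om (fun x => f x + g x) = phi om f + phi om g,
      forall om c f, bmeas f -> phi om (fun x => c * f x) = c * phi om f,
      forall om f c, bmeas f -> (forall x, `|f x| <= c) -> `|phi om f| <= c &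
      forall f, bmeas f -> measurable_fun [set: Om] (phi ^~ f)].

Lemma random_mean_eval (X : Om -> T) : measurable_fun [set: Om] X ->
  random_mean (fun om f => f (X om)).
Proof.
move=> mX; split=> // f [mf _]; exact: measurableT_comp.
Qed.

Lemma random_mean_int (mu : Om -> probability T R) :
  (forall A, measurable A -> measurable_fun [set: Om] (fun om => mu om A)) ->
  random_mean (fun om f => \int[mu om]_x f x).
Proof.
move=> mmu; split=> [om f g|om c f|om f c|f bf].
- exact: RexpD.
- exact: RexpZ.
- exact: Rexp_bound.
have [M M0 fM] := bmeas_ge0_bound bf.
have bfM : bmeas (fun x => f x + M) by exact/bmeasD/bmeas_cst.
(* Measurability of integrals against a kernel is available for nonnegative integrands, so [f] is
   shifted by its bound and the shift subtracted. *)
rewrite (_ : (fun om => _) =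
    (fun om => fine (\int[mu om]_x (f x + M)%:E)%E - M)); last first.
  apply/funext => om; rewrite -[fine _]/(\int[mu om]_x (f x + M)).
  by rewrite RexpD ?Rexp_cst ?addrK//; exact: bmeas_cst.
apply: measurable_funB; last exact: measurable_cst.
apply: measurableT_comp; first exact: fine_measurable.
apply: (@measurable_fun_integral_kernel _ _ _ _ _
  (fun om => mu om : {measure set T -> \bar R})).
- exact: mmu.
- by move=> x; rewrite lee_fin; have /ler_normlP[] := fM x; lra.
- by apply/measurable_EFinP; case: bfM.
Qed.

Lemma bmeas_random_mean phi f : random_mean phi -> bmeas f ->
  bmeas (fun om => phi om f).
Proof.
move=> [_ _ phib mphi] bf; split; first exact: mphi.
by have [_ [M fM]] := bf; exists M => om; exact: phib.
Qed.

Definition upd {A : Type} (f : nat -> A) (j : nat) (g : A) : nat -> A :=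
  fun i => if i == j then g else f i.

(** Product moments are multilinear: with all slots but [j] frozen, the remaining factors form a
    bounded weight, and slot [j] sees a bounded linear functional. This is what makes [bfun_ext]
    applicable slot by slot. *)
Lemma bfun_upd (W : Om -> R) (phi : nat -> Om -> (T -> R) -> R) k j f :
  bmeas W -> (forall i, random_mean (phi i)) -> (forall i, bmeas (f i)) ->
  (j < k)%N ->
  bfun (fun g => \int[P]_om (W om * \prod_(i < k) phi i om (upd f j g i))).
Proof.
move=> bW rphi bf jk; have [phiD phiZ phib _] := rphi j.
pose G om := W om * \prod_(i < k | i != Ordinal jk) phi i om (f i).
have bG : bmeas G.
  apply: bmeasM => //; under eq_fun do rewrite -big_filter.
  by apply: bmeas_prod => i; exact: bmeas_random_mean.
have E g : (fun om => W om * \prod_(i < k) phi i om (upd f j g i)) =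
           (fun om => phi j om g * G om).
  apply/funext => om; rewrite (bigD1 (Ordinal jk))//= /upd eqxx /G mulrCA.
  congr (_ * (_ * _)); apply: eq_bigr => i; rewrite -val_eqE/= => /negbTE.
  by move=> ->.
have [C C0 GC] := bmeas_ge0_bound bG.
have bphi g : bmeas g -> bmeas (fun om => phi j om g).
  by move=> bg; exact: bmeas_random_mean.
split=> [g h bg bh|c g bg|].
- rewrite !E -RexpD; [|exact/bmeasM/bG/bphi|exact/bmeasM/bG/bphi].
  by apply: eq_Rintegral => om _; rewrite phiD// mulrDl.
- rewrite !E -RexpZ; last exact/bmeasM/bG/bphi.
  by apply: eq_Rintegral => om _; rewrite phiZ// mulrA.
exists C => g c bg gc; rewrite E; apply: Rexp_bound => [|om].
  exact/bmeasM/bG/bphi.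
by rewrite normrM mulrC ler_pM// phib.
Qed.

(** Induction on [j]: slots below [j] may carry any bounded measurable functions while the others
    still carry indicators. Freeing slot [j] is one use of [bfun_ext]. *)
Lemma Rexp_prod_ext (W : Om -> R) (phi psi : nat -> Om -> (T -> R) -> R) k :
  bmeas W -> (forall i, random_mean (phi i)) ->
  (forall i, random_mean (psi i)) ->
  (forall A : nat -> set T, (forall i, measurable (A i)) ->
    \int[P]_om (W om * \prod_(i < k) phi i om \1_(A i)) =
    \int[P]_om (W om * \prod_(i < k) psi i om \1_(A i))) ->
  forall f : nat -> T -> R, (forall i, bmeas (f i)) ->
    \int[P]_om (W om * \prod_(i < k) phi i om (f i)) =
    \int[P]_om (W om * \prod_(i < k) psi i om (f i)).
Proof.
move=> bW rphi rpsi HA.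
suff H j : (j <= k)%N -> forall f : nat -> T -> R, (forall i, bmeas (f i)) ->
    (forall i, (j <= i)%N -> exists2 A, measurable A & f i = \1_A) ->
    \int[P]_om (W om * \prod_(i < k) phi i om (f i)) =
    \int[P]_om (W om * \prod_(i < k) psi i om (f i)).
  (* Slots from [k] on do not enter the product; filling them with the indicator of the whole space
     meets the requirement of the invariant at [j = k]. *)
  move=> f bf; pose f' i := if (i < k)%N then f i else \1_setT.
  have E (chi : nat -> Om -> (T -> R) -> R) om : \prod_(i < k) chi i om (f i) =
                  \prod_(i < k) chi i om (f' i) :> R.
    by apply: eq_bigr => i _; rewrite /f' ltn_ord.
  under eq_Rintegral do rewrite E; under [RHS]eq_Rintegral do rewrite E.
  apply: (H k) => // i; rewrite /f'; first by case: ifP => // _; exact: bmeas_indic.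
  by rewrite leqNgt => /negbTE ->; exists setT.
elim: j => [_ f bf fA|j IH jk f bf fA].
  have /choice[A AP] : forall i, exists A, measurable A /\ f i = \1_A.
    by move=> i; have [A mA fiA] := fA i isT; exists A.
  have fE i : f i = \1_(A i) by case: (AP i).
  have mA i : measurable (A i) by case: (AP i).
  have E (chi : nat -> Om -> (T -> R) -> R) om : \prod_(i < k) chi i om (f i) =
                  \prod_(i < k) chi i om \1_(A i) :> R.
    by apply: eq_bigr => i _; rewrite fE.
  by under eq_Rintegral do rewrite E; under [RHS]eq_Rintegral do rewrite E;
    exact: HA.
have fE : f = upd f j (f j).
  by apply/funext => i; rewrite /upd; case: eqP => // ->.
rewrite fE; apply: (bfun_ext (bfun_upd bW rphi bf jk) (bfun_upd bW rpsi bf jk)) => //.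
move=> A mA; apply: IH => [|i|i ji]; first exact: ltnW.
  by rewrite /upd; case: eqP => // _; exact: bmeas_indic.
rewrite /upd; case: eqP => [_|/eqP ij]; first by exists A.
by apply: fA; rewrite ltn_neqAle eq_sym ij.
Qed.

End RandomMeans.

(** * Open sets of S^oo and cylinder functions *)

Lemma measurable_borel_continuous {R : realType} {S : ptopologicalType}
    (f : S -> R) :
  continuous f -> measurable_fun [set: borel S] (f : borel S -> R).
Proof.
move=> cf; apply: (measurability _ (RGenOpens.measurableE R)) => // _ [_ [a [b ->]] <-].
rewrite setTI; apply: sub_sigma_algebra.
by move/continuousP: cf; apply; exact: interval_open.
Qed.

Lemma bmeas_borel_continuous {R : realType} {S : ptopologicalType} (f : S -> R) :
  bounded_continuous f -> bmeas (f : borel S -> R).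
Proof.
by move=> [cf bf]; split => //; exact: measurable_borel_continuous.
Qed.

Section TruncatedDistance.
Context {R : realType} {S : completePseudoMetricType R}.

(* Truncation at 1 keeps the infimum finite: a ball of a pseudometric space need
   not contain every point, however large its radius. *)
Definition tdist (a x : S) : R := inf [set r | 0 < r /\ (ball a r x \/ r = 1)].

Let tdist_has_lbound (a x : S) :
  has_lbound [set r : R | 0 < r /\ (ball a r x \/ r = 1)].
Proof. by exists 0 => r [/ltW]. Qed.

Let tdist_nonempty (a x : S) : [set r : R | 0 < r /\ (ball a r x \/ r = 1)] !=set0.
Proof. by exists 1; split => //; right. Qed.

Lemma tdist_le a x r : 0 < r -> ball a r x -> tdist a x <= r.
Proof. by move=> r0 ar; apply: ge_inf => //; split => //; left. Qed.

(** The truncation value 1 always belongs to the set whose infimum is taken, so a value below [r]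
    certifies membership in the ball only when [r <= 1]. *)
Lemma tdist_lt_ball a x r : r <= 1 -> tdist a x < r -> ball a r x.
Proof.
move=> r1 /inf_lt[//|s [s0 [bs|->]] sr]; first exact: le_ball (ltW sr) _ bs.
by move: sr; rewrite ltNge r1.
Qed.

Lemma tdist_lip a x y e : 0 < e -> ball x e y -> tdist a y <= tdist a x + e.
Proof.
move=> e0 xy; rewrite -lerBlDr; apply: lb_le_inf => // r [r0 ar].
rewrite lerBlDr; case: ar => [ar|->].
  by apply: tdist_le; [rewrite addr_gt0|exact: ball_triangle xy].
apply: (@le_trans _ _ 1); last by rewrite lerDl ltW.
by apply: ge_inf => //; split => //; right.
Qed.

Lemma tdist_continuous a : continuous (tdist a).
Proof.
move=> x; apply/cvgrPdist_le => e e0; near=> y.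
have xy : ball x e y by near: y; exact: nbhsx_ballx.
by rewrite ler_distl lerBlDr !tdist_lip//; exact: ball_sym.
Unshelve. all: by end_near. Qed.

End TruncatedDistance.

(** * Inner approximation of open sets of the sequence space *)

Section Cylinders.
Context {R : realType} {S : completePseudoMetricType R}.
Variable q : nat -> S.
Hypothesis q_dense : forall (x : S) (e : R), 0 < e -> exists m, ball x e (q m).

(** A pair [(m, c)] with [c > 0] encodes the region around [q m] at truncated distance below [1/c],
    which is where the bump is positive; [c = 0] encodes the whole space. Integer codes make finite
    lists of constraints countable. *)
Definition bump (b : nat * nat) (x : S) : R := 1 - b.2%:R * tdist (q b.1) x.

Lemma bump_continuous b : continuous (bump b).
Proof.
move=> x; apply: cvgB; first exact: cvg_cst.
by apply: cvgM; [exact: cvg_cst|exact: tdist_continuous].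
Qed.

Lemma bump_base (x : S) (e : R) : 0 < e ->
  exists b, 0 < bump b x /\ forall y, 0 < bump b y -> ball x e y.
Proof.
(* The centre is taken within [1/(2c)] of [x], so every point of positive bump lies within
   [1/(2c) + 1/c = 3/(2c) < e] of [x]. *)
move=> e0; pose c := (Num.truncn (2 / e)).+1.
have ce : 2 / e < c%:R by rewrite truncnS_gt.
have c0 : (0 : R) < c%:R by [].
have [m xm] := q_dense x (ltac:(by rewrite invr_gt0 mulr_gt0) : 0 < (2 * c%:R : R)^-1).
exists (m, c); rewrite /bump/=; split.
  have := tdist_le _ (ball_sym xm); rewrite invr_gt0 mulr_gt0// => /(_ isT) h.
  rewrite subr_gt0 -ltr_pdivlMl// mulr1 (le_lt_trans h)//.
  by rewrite ltf_pV2 ?posrE ?mulr_gt0//; lra.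
move=> y; rewrite subr_gt0 -ltr_pdivlMl// mulr1 => h.
have cy : ball (q m) c%:R^-1 y.
  by apply: tdist_lt_ball h; rewrite invf_le1// (ler_nat _ 1).
apply: le_ball (ball_triangle xm cy).
rewrite invfM -[X in _ + X]mul1r -mulrDl.
rewrite ler_pdivrMr// mulrC -ler_pdivrMr//.
by move: ce; rewrite ltr_pdivrMr// ler_pdivrMr//; lra.
Qed.

Definition cylinder (s : seq (nat * nat)) : set (nat -> S) :=
  [set v | forall i, (i < size s)%N -> 0 < bump (nth (0, 0)%N s i) (v i)].

(** Otherwise, for every [k], the cylinder holding the first [k] coordinates within [1/(k+1)] of
    those of [z] contains a point outside [G]. These points converge to [z] coordinatewise, hence
    for the product topology, and must enter the open set [G]. *)
Lemma cylinder_base (G : set {ptws nat -> S}) (z : {ptws nat -> S}) :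
  open G -> G z -> exists2 s, cylinder s z & cylinder s `<=` G.
Proof.
move=> oG Gz; apply: contrapT => H.
have /choice[pr prP] : forall ik : nat * nat, exists b, 0 < bump b (z ik.1) /\
    forall y, 0 < bump b y -> ball (z ik.1) (ik.2.+1%:R^-1) y.
  by move=> [i k] /=; apply: bump_base; rewrite invr_gt0.
pose s k := [seq pr (i, k) | i <- iota 0 k].
have sE k i : (i < k)%N -> nth (0, 0)%N (s k) i = pr (i, k).
  by move=> ik; rewrite /s (nth_map 0%N) ?size_iota// nth_iota.
have ss k : size (s k) = k by rewrite size_map size_iota.
have /choice[v vP] : forall k, exists v, cylinder (s k) v /\ ~ G v.
  move=> k; apply: contrapT => Hk; apply: H; exists (s k).
    by move=> i; rewrite ss => ik; rewrite sE//; have [] := prP (i, k).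
  by move=> v sv; apply: contrapT => Gv; apply: Hk; exists v.
have : v @ \oo --> z.
  apply/cvg_sup => i; apply/cvg_image.
    by rewrite eqEsubset; split => // y _; exists (fun=> y).
  move=> W /= /nbhs_ballP[e /= e0 eW].
  exists (@^~ i @^-1` W); last first.
    by rewrite image_preimage// eqEsubset; split => // y _; exists (fun=> y).
  rewrite /nbhs/=; near=> k; apply: eW.
  have ik : (i < k)%N by near: k; exact: nbhs_infty_gt.
  have [/(_ i)] := vP k; rewrite ss sE// => /(_ ik) bi _.
  have [_ /(_ _ bi)] := prP (i, k); apply: le_ball => /=.
  by apply/ltW; near: k; exact: near_infty_natSinv_lt (PosNum e0).
move=> /(_ G) /(_ (open_nbhs_nbhs (conj oG Gz)))[k _ /(_ k (leqnn _))] /=.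
by have [] := vP k.
Unshelve. all: by end_near. Qed.

(** A continuous function that vanishes where the bump is nonpositive and, for large [N], equals 1
    at any given point where it is positive. *)
Definition ramp (N : nat) (b : nat * nat) (x : S) : R :=
  Num.max 0 (Num.min 1 (N%:R * bump b x)).

Lemma ramp_continuous N b : continuous (ramp N b).
Proof.
move=> x; apply: (@continuous_max R S (fun=> 0)
  (fun y => Num.min 1 (N%:R * bump b y))); first exact: cvg_cst.
apply: (@continuous_min R S (fun=> 1) (fun y => N%:R * bump b y)).
  exact: cvg_cst.
by apply: cvgM; [exact: cvg_cst|exact: bump_continuous].
Qed.

Lemma ramp01 N b x : 0 <= ramp N b x <= 1.
Proof. by rewrite /ramp le_max lexx/= ge_max ler01 ge_min lexx. Qed.

Definition cylf (s : seq (nat * nat)) (N i : nat) (x : S) : R :=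
  if (i < size s)%N then ramp N (nth (0, 0)%N s i) x else 1.

Definition unit_continuous (f : S -> R) :=
  continuous f /\ forall x, 0 <= f x <= 1.

Lemma unit_continuous_cylf s N i : unit_continuous (cylf s N i).
Proof.
rewrite /cylf; case: (i < size s)%N.
  by split; [exact: ramp_continuous|exact: ramp01].
by split => [x|x]; [exact: cvg_cst|rewrite ler01 lexx].
Qed.

Definition cylp (K : nat) (f : nat -> S -> R) (v : nat -> S) : R :=
  \prod_(i < K) f i (v i).

Lemma cylp01 K f v : (forall i, unit_continuous (f i)) -> 0 <= cylp K f v <= 1.
Proof.
move=> cf; apply/andP; split.
  by apply: prodr_ge0 => i _; case: (cf i) => _ /(_ (v i))/andP[].
by apply: prodr_ile1 => i _; case: (cf i).
Qed.

(** The cylinders contained in [G] among the first [N] codes. The condition [size s <= N] ensures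
    that [cylp N], which reads only [N] coordinates, tests every constraint of [s]. *)
Definition inner (G : set (nat -> S)) (N : nat) : seq (seq (nat * nat)) :=
  [seq s <- pmap unpickle (iota 0 N) |
    (size s <= N)%N && `[< cylinder s `<=` G >]].

Definition psi (G : set (nat -> S)) (N : nat) (v : nat -> S) : R :=
  1 - \prod_(s <- inner G N) (1 - cylp N (cylf s N) v).

Lemma psi01 G N v : 0 <= psi G N v <= 1.
Proof.
have H s : 0 <= 1 - cylp N (cylf s N) v <= 1.
  have /andP[? ?] := cylp01 N v (unit_continuous_cylf s N); lra.
suff : 0 <= \prod_(s <- inner G N) (1 - cylp N (cylf s N) v) <= 1.
  by rewrite /psi; lra.
by rewrite prodr_ge0 ?prodr_ile1// => s _; case/andP: (H s).
Qed.

(** A point outside [G] violates a constraint of each listed cylinder. The corresponding ramp is 0,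
    so every factor of the product is 1. *)
Lemma psi_out G N v : ~ G v -> psi G N v = 0.
Proof.
move=> Gv; rewrite /psi big_seq big1 ?subrr// => s.
rewrite mem_filter => /andP[/andP[sN /asboolP sG] _].
have [i is_ bi] : exists2 i, (i < size s)%N & bump (nth (0, 0)%N s i) (v i) <= 0.
  apply: contrapT => H; apply/Gv/sG => i ilt; rewrite ltNge.
  by apply/negP => bi; apply: H; exists i.
rewrite /cylp (bigD1 (Ordinal (leq_trans is_ sN)))//= {1}/cylf is_.
rewrite (_ : ramp _ _ _ = 0) ?mul0r ?subr0//.
rewrite /ramp; apply/max_idPl; rewrite ge_min; apply/orP; right.
by rewrite mulr_ge0_le0.
Qed.

(** One cylinder [s] around [v] inside [G] suffices: once [s] is listed and its ramps have all
    reached 1, its factor annihilates the product. *)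
Lemma psi_in G v : open (G : set {ptws nat -> S}) -> G v ->
  \forall N \near \oo, psi G N v = 1.
Proof.
move=> oG Gv; have [s sv sG] := cylinder_base oG Gv.
near=> N; have sN : (size s <= N)%N by near: N; exact: nbhs_infty_ge.
have sin : s \in inner G N.
  rewrite mem_filter sN asboolT//= mem_pmap; apply/mapP.
  exists (pickle s); last by rewrite pickleK.
  by rewrite mem_iota add0n/=; near: N; exact: nbhs_infty_gt.
rewrite /psi (big_rem _ sin)/= (_ : cylp _ _ _ = 1) ?subrr ?mul0r ?subr0//.
rewrite /cylp big1// => i _; rewrite /cylf; case: ifP => // is_.
rewrite /ramp; apply/eqP; rewrite (_ : Num.min _ _ = 1) ?(max_idPr ler01)//.
apply/min_idPl.
(* Quantifying over the finite type of constrained coordinates lets a single [N] serve all of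
   them. *)
have : forall j : 'I_(size s), 1 <= N%:R * bump (nth (0, 0)%N s j) (v j).
  near: N; apply: filter_forall => j.
  have bj := sv j (ltn_ord j); near=> N; rewrite -ler_pdivrMr//.
  by near: N; exact: nbhs_infty_ger.
by move=> /(_ (Ordinal is_)).
Unshelve. all: by end_near. Qed.

Lemma psi_cvg G v : open (G : set {ptws nat -> S}) ->
  psi G N v @[N --> \oo] --> (`[< G v >]%:R : R).
Proof.
move=> oG; have [Gv|Gv] := asboolP (G v).
  apply: cvg_near_cst; apply: filterS (psi_in oG Gv) => N ->; exact/eqP.
by under eq_fun do rewrite psi_out//; exact: cvg_cst.
Qed.

End Cylinders.

(** * Convergence in distribution from product moments *)

Section ProductMoments.
Context {R : realType} {S : completePseudoMetricType R}.
Variable q : nat -> S.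
Hypothesis q_dense : forall (x : S) (e : R), 0 < e -> exists m, ball x e (q m).

Section measurability.
Context {d} {Om : measurableType d} (x : nat -> Om -> borel S).
Hypothesis mx : forall i, measurable_fun [set: Om] (x i).

Let X (om : Om) : nat -> S := fun i => x i om.

Lemma bmeas_cylp K (f : nat -> S -> R) : (forall i, unit_continuous (f i)) ->
  bmeas (fun om => cylp K f (X om)).
Proof.
move=> cf; apply: bmeas_prod => i.
apply: (@bmeas_comp _ _ (borel S) _ _ (f i) (x i)) => //.
apply: bmeas_borel_continuous; have [cfi f01] := cf i.
by split => //; exists 1 => z; have /andP[? ?] := f01 z; rewrite ger0_norm.
Qed.

Lemma bmeas_psi G N : bmeas (fun om => psi q G N (X om)).
Proof.
apply: bmeasB; first exact: bmeas_cst.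
apply: bmeas_prod => s; apply: bmeasB; first exact: bmeas_cst.
by apply: bmeas_cylp => i; exact: unit_continuous_cylf.
Qed.

(** [layers K] of [H] with the indicator of each superlevel set, open when [H] is continuous,
    replaced by its inner approximation. The result is a polynomial in continuous functions of
    single coordinates. *)
Definition psi_layers (H : (nat -> S) -> R) (K N : nat) (v : nat -> S) : R :=
  K%:R^-1 * \sum_(k < K) psi q [set v | k.+1%:R / K%:R < H v] N v.

Lemma bmeas_psi_layers H K N : bmeas (fun om => psi_layers H K N (X om)).
Proof. by apply/bmeasZ/bmeas_sum => k; exact: bmeas_psi. Qed.

Lemma psi_layers_le H K N v : psi_layers H K N v <= layers K (H v).
Proof.
rewrite /psi_layers /layers ler_wpM2l ?invr_ge0//; apply: ler_sum => k _.
have [kH|Hk] := ltP; first by have /andP[] := psi01 q [set v | k.+1%:R / K%:R < H v] N v.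
by rewrite psi_out//=; apply/negP; rewrite -leNgt.
Qed.

Lemma psi_layers_ge0 H K N v : 0 <= psi_layers H K N v.
Proof.
rewrite mulr_ge0 ?invr_ge0//; apply: sumr_ge0 => k _.
by have /andP[] := psi01 q [set v | k.+1%:R / K%:R < H v] N v.
Qed.

Variable H : {ptws nat -> S} -> R.
Hypothesis cH : continuous H.
Hypothesis H01 : forall v, 0 <= H v <= 1.

Lemma psi_layers_cvg K v :
  psi_layers H K N v @[N --> \oo] --> layers K (H v).
Proof.
rewrite /psi_layers /layers; apply: cvgM; first exact: cvg_cst.
apply: (cvg_big (op := +%R)) => [|k _]; first exact: add_continuous.
have -> : (k.+1%:R / K%:R < H v) = `[< [set v | k.+1%:R / K%:R < H v] v >].
  by apply/idP/asboolP.
apply: psi_cvg => //.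
rewrite (_ : [set v | _] = H @^-1` `]k.+1%:R / K%:R, +oo[%classic).
  by move/continuousP : cH; apply; exact: interval_open.
by apply/seteqP; split => w /=; rewrite in_itv/= andbT.
Qed.

Lemma bmeas_layersH K : bmeas (fun om => layers K (H (X om))).
Proof.
split.
  apply: (@measurable_fun_cvg _ _ _ _ (fun N om => psi_layers H K N (X om))).
    by move=> N; case: (bmeas_psi_layers H K N).
  by move=> om _; exact: psi_layers_cvg.
exists 1 => om; have /andP[H0 H1] := H01 (X om).
rewrite ger0_norm ?(le_trans (layers_le _ _))//.
by rewrite mulr_ge0 ?invr_ge0// sumr_ge0.
Qed.

(** Measurability is obtained by two pointwise limits: cylinder approximations converge to
    [layers K], and these converge to [H] as [K] grows. No comparison of the Borel and product
    sigma-algebras on the sequence space is involved. *)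
Lemma bmeas_ptws_continuous01 : bmeas (fun om => H (X om)).
Proof.
split; last by exists 1 => om; have /andP[? ?] := H01 (X om); rewrite ger0_norm.
apply: (@measurable_fun_cvg _ _ _ _ (fun K om => layers K.+1 (H (X om)))).
  by move=> K; case: (bmeas_layersH K.+1).
move=> om _; apply/cvgrPdist_le => e e0; near=> K.
have /andP[H0 H1] := H01 (X om).
rewrite ger0_norm ?subr_ge0 ?layers_le//.
apply: (@le_trans _ _ K.+1%:R^-1); first by rewrite lerBlDl ge_layers.
by apply/ltW; near: K; exact: near_infty_natSinv_lt (PosNum e0).
Unshelve. all: by end_near. Qed.

Lemma psi_layers_Rexp (P : probability Om R) (e : R) : 0 < e ->
  exists K N, \int[P]_om H (X om) - e <= \int[P]_om psi_layers H K N (X om).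
Proof.
move=> e0; have e20 : 0 < e / 2 by rewrite divr_gt0.
(* The error [e] is shared equally: [K] controls the layer cake error, and [N], found by bounded
   convergence, the cylinder error. *)
pose K := (Num.truncn (2 / e)).+1.
have Ke : K%:R^-1 <= e / 2.
  by rewrite -[e / 2]invrK lef_pV2 ?posrE ?invr_gt0// invf_div ltW ?truncnS_gt.
have : \int[P]_om psi_layers H K N (X om) @[N --> \oo] -->
       \int[P]_om layers K (H (X om)).
  apply: (@Rexp_bounded_cvg _ _ _ _ _ _ 1).
  - by move=> N; exact: bmeas_psi_layers.
  - exact: bmeas_layersH.
  - apply: aeW => om N; rewrite ger0_norm ?psi_layers_ge0//.
    rewrite (le_trans (psi_layers_le _ _ _ _))//.
    by have /andP[? ?] := H01 (X om); rewrite (le_trans (layers_le _ _)).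
  - by apply: aeW => om; exact: psi_layers_cvg.
move=> /cvgrPdist_le /(_ _ e20)[N _ /(_ N (leqnn _))] /=.
rewrite ler_distl => /andP[_ h]; exists K, N.
have : \int[P]_om H (X om) <= \int[P]_om (layers K (H (X om)) + K%:R^-1).
  apply: le_Rexp; first exact: bmeas_ptws_continuous01.
    by apply: bmeasD; [exact: bmeas_layersH|exact: bmeas_cst].
  by move=> om; have /andP[? ?] := H01 (X om); exact: ge_layers.
rewrite RexpD ?Rexp_cst; [|exact: bmeas_layersH|exact: bmeas_cst].
move: h; lra.
Qed.

End measurability.

Context {dO : nat -> measure_display} {Om : forall n, measurableType (dO n)}
  (P : forall n, probability (Om n) R) (x : forall n, nat -> Om n -> borel S)
  {d'} {Om' : measurableType d'} (Q : probability Om' R)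
  (y : nat -> Om' -> borel S).
Arguments x : clear implicits.
Hypothesis mx : forall n i, measurable_fun [set: Om n] (x n i).
Hypothesis my : forall i, measurable_fun [set: Om'] (y i).
Hypothesis moments : forall K (f : nat -> S -> R),
  (forall i, unit_continuous (f i)) ->
  \int[P n]_om cylp K f (fun i => x n i om) @[n --> \oo] -->
  \int[Q]_om cylp K f (fun i => y i om).

(** The additional factor [cylp K f] closes the induction: multiplying it by [1 - cylp K (g s)]
    gives a difference of two factors of the same kind, since products of coordinate functions
    multiply coordinatewise. *)
Let cvg_cylp_prodC I (r : seq I) K (f : nat -> S -> R) (g : I -> nat -> S -> R) :
  (forall i, unit_continuous (f i)) ->
  (forall s i, unit_continuous (g s i)) ->
  \int[P n]_om (cylp K f (fun i => x n i om) *
    \prod_(s <- r) (1 - cylp K (g s) (fun i => x n i om))) @[n --> \oo] -->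
  \int[Q]_om (cylp K f (fun i => y i om) *
    \prod_(s <- r) (1 - cylp K (g s) (fun i => y i om))).
Proof.
move=> + cg; elim: r f => [|s r IH] f cf.
  have E d'' (O : measurableType d'') (PO : probability O R)
      (z : nat -> O -> borel S) :
    \int[PO]_om (cylp K f (fun i => z i om) *
      \prod_(s <- [::]) (1 - cylp K (g s) (fun i => z i om))) =
    \int[PO]_om cylp K f (fun i => z i om).
    by apply: eq_Rintegral => om _; rewrite big_nil mulr1.
  by under eq_cvg do rewrite E; rewrite E; exact: moments.
pose fg i z := f i z * g s i z.
have cfg i : unit_continuous (fg i).
  have [cfi f01] := cf i; have [cgi g01] := cg s i.
  split=> [z|z]; first by apply: cvgM; [exact: cfi|exact: cgi].
  have /andP[? ?] := f01 z; have /andP[? ?] := g01 z.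
  by rewrite mulr_ge0// mulr_ile1.
have E (v : nat -> S) : cylp K f v * \prod_(s <- s :: r) (1 - cylp K (g s) v) =
    cylp K f v * \prod_(s <- r) (1 - cylp K (g s) v) -
    cylp K fg v * \prod_(s <- r) (1 - cylp K (g s) v).
  have -> : cylp K fg v = cylp K f v * cylp K (g s) v by rewrite /cylp -big_split.
  by rewrite big_cons; ring.
have b d'' (O : measurableType d'') (z : nat -> O -> borel S) h :
    (forall i, measurable_fun [set: O] (z i)) ->
    (forall i, unit_continuous (h i)) ->
    bmeas (fun om => cylp K h (fun i => z i om) *
      \prod_(s <- r) (1 - cylp K (g s) (fun i => z i om))).
  move=> mz ch; apply: bmeasM; first exact: bmeas_cylp.
  by apply: bmeas_prod => t; apply: bmeasB; [exact: bmeas_cst|exact: bmeas_cylp].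
have EI d'' (O : measurableType d'') (PO : probability O R)
    (z : nat -> O -> borel S) : (forall i, measurable_fun [set: O] (z i)) ->
  \int[PO]_om (cylp K f (fun i => z i om) *
    \prod_(s <- s :: r) (1 - cylp K (g s) (fun i => z i om))) =
  \int[PO]_om (cylp K f (fun i => z i om) *
    \prod_(s <- r) (1 - cylp K (g s) (fun i => z i om))) -
  \int[PO]_om (cylp K fg (fun i => z i om) *
    \prod_(s <- r) (1 - cylp K (g s) (fun i => z i om))).
  move=> mz; rewrite -RexpB; [|exact: b|exact: b].
  by apply: eq_Rintegral => om _; exact: E.
under eq_cvg do rewrite EI//; rewrite EI//.
by apply: cvgB; exact: IH.
Qed.

Let cvg_psi G N :
  \int[P n]_om psi q G N (fun i => x n i om) @[n --> \oo] -->
  \int[Q]_om psi q G N (fun i => y i om).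
Proof.
have c1 : forall i : nat, unit_continuous (fun _ : S => 1 : R).
  by move=> _; split => z; [exact: cvg_cst|rewrite ler01 lexx].
have E (v : nat -> S) : psi q G N v =
    1 - cylp N (fun _ _ => 1) v * \prod_(s <- inner q G N) (1 - cylp N (cylf q s N) v).
  by rewrite /psi [cylp N (fun _ _ => 1) v]big1// mul1r.
have b d'' (O : measurableType d'') (z : nat -> O -> borel S) :
    (forall i, measurable_fun [set: O] (z i)) ->
    bmeas (fun om => cylp N (fun _ _ => 1 : R) (fun i => z i om) *
      \prod_(s <- inner q G N) (1 - cylp N (cylf q s N) (fun i => z i om))).
  move=> mz; apply: bmeasM; first exact: bmeas_cylp.
  apply: bmeas_prod => t; apply: bmeasB; first exact: bmeas_cst.
  by apply: bmeas_cylp => // i; exact: unit_continuous_cylf.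
have EI d'' (O : measurableType d'') (PO : probability O R)
    (z : nat -> O -> borel S) : (forall i, measurable_fun [set: O] (z i)) ->
  \int[PO]_om psi q G N (fun i => z i om) =
  1 - \int[PO]_om (cylp N (fun _ _ => 1 : R) (fun i => z i om) *
    \prod_(s <- inner q G N) (1 - cylp N (cylf q s N) (fun i => z i om))).
  move=> mz; rewrite -[X in X - _](Rexp_cst PO) -RexpB; [|exact: bmeas_cst|exact: b].
  by apply: eq_Rintegral => om _; exact: E.
under eq_cvg do rewrite EI//; rewrite EI//.
apply: cvgB; first exact: cvg_cst.
apply: cvg_cylp_prodC => // s i; exact: unit_continuous_cylf.
Qed.

(** The approximation [psi_layers] is nearly optimal under [Q], its expectation converges by the
    moment hypothesis, and it lies below [H] under every [P n]. Only the first two steps cost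
    [e / 2] each. *)
Let liminf_Rexp (H : {ptws nat -> S} -> R) (e : R) :
  continuous H -> (forall v, 0 <= H v <= 1) -> 0 < e ->
  \forall n \near \oo, \int[Q]_om H (fun i => y i om) - e <=
                       \int[P n]_om H (fun i => x n i om).
Proof.
move=> cH H01 e0; have e20 : 0 < e / 2 by rewrite divr_gt0.
have [K [N KN]] := psi_layers_Rexp my cH H01 Q e20.
have : \int[P n]_om psi_layers H K N (fun i => x n i om) @[n --> \oo] -->
       \int[Q]_om psi_layers H K N (fun i => y i om).
  have E d'' (O : measurableType d'') (PO : probability O R)
      (z : nat -> O -> borel S) : (forall i, measurable_fun [set: O] (z i)) ->
    \int[PO]_om psi_layers H K N (fun i => z i om) = K%:R^-1 * \sum_(k < K)
      \int[PO]_om psi q [set v | k.+1%:R / K%:R < H v] N (fun i => z i om).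
    move=> mz; rewrite RexpZ ?Rexp_sum//.
      by move=> k; exact: bmeas_psi.
    by apply: bmeas_sum => k; exact: bmeas_psi.
  under eq_cvg do rewrite E//; rewrite E//.
  apply: cvgM; first exact: cvg_cst.
  by apply: (cvg_big (op := +%R)) => [|k _]; [exact: add_continuous|];  exact: cvg_psi.
move=> /cvgrPdist_le /(_ _ e20); apply: filterS => n.
rewrite ler_distl => /andP[_ h].
have : \int[P n]_om psi_layers H K N (fun i => x n i om) <=
       \int[P n]_om H (fun i => x n i om).
  apply: le_Rexp; first exact: bmeas_psi_layers.
    exact: bmeas_ptws_continuous01.
  move=> om; apply: le_trans (psi_layers_le _ _ _ _) _; apply: layers_le.
  by have /andP[] := H01 (fun i => x n i om).
move: h KN; lra.
Qed.

Lemma cvg_dist_product_moments :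
  @cvg_dist R {ptws nat -> S} dO Om P
    (fun n om => (fun i => x n i om) : {ptws nat -> S})
    d' Om' Q (fun om => (fun i => y i om) : {ptws nat -> S}).
Proof.
move=> F [cF [M0 FM0]].
pose M : R := `|M0| + 1.
have M1 : 0 < M by rewrite /M ltr_wpDl.
have FM v : - M <= F v <= M.
  by rewrite -ler_norml (le_trans (FM0 v))// (le_trans (ler_norm _))// lerDl.
pose H (v : {ptws nat -> S}) : R := (2 * M)^-1 * (F v + M).
have M20 : 0 < 2 * M by rewrite mulr_gt0.
have H01 v : 0 <= H v <= 1.
  have /andP[? ?] := FM v.
  by rewrite /H mulrC divr_ge0 ?ler_pdivrMr//; lra.
have cH : continuous (H : {ptws nat -> S} -> R).
  move=> v; rewrite /H.
  apply: (@cvgM R {ptws nat -> S} (nbhs v) _ (fun=> (2 * M)^-1) (fun w => F w + M)).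
    exact: cvg_cst.
  apply: (@cvgD R R {ptws nat -> S} (nbhs v) _ F (fun=> M)); last exact: cvg_cst.
  exact: cF.
(* The one-sided estimate for [1 - H] supplies the upper bound for [H]. *)
have cH' : continuous ((fun v => 1 - H v) : {ptws nat -> S} -> R).
  move=> v; apply: (@cvgB R R {ptws nat -> S} (nbhs v) _ (fun=> 1) H).
    exact: cvg_cst.
  exact: cH.
have H01' v : 0 <= 1 - H v <= 1 by have /andP[? ?] := H01 v; lra.
have FE v : F v = 2 * M * H v - M.
  by rewrite /H mulrA divff ?gt_eqF// mul1r addrK.
have b d'' (O : measurableType d'') (z : nat -> O -> borel S) :
    (forall i, measurable_fun [set: O] (z i)) ->
    bmeas (fun om => H (fun i => z i om)).
  by move=> mz; exact: bmeas_ptws_continuous01.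
have E d'' (O : measurableType d'') (PO : probability O R)
      (z : nat -> O -> borel S) : (forall i, measurable_fun [set: O] (z i)) ->
    \int[PO]_om F (fun i => z i om) = 2 * M * \int[PO]_om H (fun i => z i om) - M.
  move=> mz; transitivity (\int[PO]_om (2 * M * H (fun i => z i om) - M)).
    by apply: eq_Rintegral => om _; exact: FE.
  have bHz := b _ _ _ mz.
  by rewrite (RexpB PO (bmeasZ (2 * M) bHz) (bmeas_cst M)) (RexpZ PO _ bHz) Rexp_cst.
under eq_cvg do rewrite E//; rewrite E//.
apply: cvgB; last exact: cvg_cst.
apply: cvgM; first exact: cvg_cst.
apply/cvgrPdist_le => e e0; near=> n.
rewrite ler_distl; apply/andP; split; last first.
  by rewrite -lerBlDr; near: n; exact: liminf_Rexp.
have : \int[Q]_om (1 - H (fun i => y i om)) - e <=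
       \int[P n]_om (1 - H (fun i => x n i om)).
  by near: n; exact: (liminf_Rexp cH' H01').
rewrite !RexpB ?Rexp_cst; [lra|exact: bmeas_cst|exact: b|exact: bmeas_cst|exact: b].
Unshelve. all: by end_near. Qed.

End ProductMoments.

(** * Product formulas *)

Section ProductFormulas.
Context {R : realType}.

Lemma prod_indic {T} (k : nat) (A : nat -> set T) (x : T) :
  \prod_(i < k) \1_(A i) x = \1_(\bigcap_(i in `I_k) A i) x :> R.
Proof.
elim: k => [|k IH]; first by rewrite big_ord0 II0 bigcap_set0 indicE in_setT.
by rewrite big_ord_recr/= IH IIS bigcap_setU bigcap_set1 indicI.
Qed.

Lemma measurable_bigcapI {d} {T : measurableType d} (k : nat) (A : nat -> set T) :
  (forall i, measurable (A i)) -> measurable (\bigcap_(i in `I_k) A i).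
Proof. by move=> mA; apply: bigcap_measurableType => i _; exact: mA. Qed.

Lemma Rexp_prod_indic {d} {T : measurableType d} (P : probability T R)
    {d'} {T' : measurableType d'} (B : set T) (k : nat) (X : nat -> T -> T')
    (A : nat -> set T') :
  measurable B -> (forall i, measurable_fun [set: T] (X i)) ->
  (forall i, measurable (A i)) ->
  \int[P]_om (\1_B om * \prod_(i < k) \1_(A i) (X i om)) =
  fine (P (B `&` \bigcap_(i in `I_k) (X i @^-1` A i))).
Proof.
move=> mB mX mA; rewrite -Rexp_indic.
  apply: eq_Rintegral => om _; rewrite indicI/=; congr (_ * _).
  rewrite -(prod_indic k (fun i => X i @^-1` A i)).
  by apply: eq_bigr => i _; rewrite !indicE.
apply: measurableI => //; apply: measurable_bigcapI => i.
by rewrite -[X in measurable X]setTI; exact: mX.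
Qed.

Lemma prob_fineK {d} {T : measurableType d} (P : probability T R) (A : set T) :
  measurable A -> (fine (P A))%:E = P A.
Proof. by move=> mA; rewrite fineK//; exact: fin_num_measure. Qed.

(** Used with [X] the identity from [Om] to the same set with a coarser sigma-algebra, to extend an
    identity from events of that sigma-algebra to its bounded functions. *)
Lemma bfun_weight {d} {T : measurableType d} (P : probability T R)
    {d'} {T' : measurableType d'} (X : T -> T') (Z : T -> R) :
  measurable_fun [set: T] X -> bmeas Z ->
  bfun (fun g : T' -> R => \int[P]_om (g (X om) * Z om)).
Proof.
move=> mX bZ; have [C C0 ZC] := bmeas_ge0_bound bZ.
have b g : bmeas g -> bmeas (fun om => g (X om) * Z om).
  by move=> bg; apply: bmeasM => //; exact: bmeas_comp.
split=> [f g bf bg|c f bf|].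
- rewrite -RexpD; [|exact: b|exact: b].
  by apply: eq_Rintegral => om _; rewrite mulrDl.
- rewrite -RexpZ; last exact: b.
  by apply: eq_Rintegral => om _; rewrite mulrA.
exists C => f c bf fc; apply: Rexp_bound; first exact: b.
by move=> om; rewrite normrM mulrC ler_pM.
Qed.

Section species.
Context {S : ptopologicalType} {dO} {Om : measurableType dO}
  (P : probability Om R).

Lemma random_mean_pprobability (mu : Om -> probability (borel S) R) :
  measurable_fun [set: Om] (mu : Om -> pprobability (borel S) R) ->
  random_mean (fun om f => \int[mu om]_x f x).
Proof.
move=> mmu; apply: random_mean_int => A mA.
exact: (measurable_kernel (kprobability mmu) A mA).
Qed.

(** On rectangles this is [cond_iid] with [C] the whole space. Both sides are product moments of
    random means, evaluation at [x i] and integration against [mu], so [Rexp_prod_ext] with weight 1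
    applies. *)
Lemma cond_iid_product (mu : Om -> probability (borel S) R)
    (x : nat -> Om -> borel S) :
  measurable_fun [set: Om] (mu : Om -> pprobability (borel S) R) ->
  cond_iid P mu x -> forall k (f : nat -> borel S -> R),
  (forall i, bmeas (f i)) ->
  \int[P]_om (\prod_(i < k) f i (x i om)) =
  \int[P]_om (\prod_(i < k) \int[mu om]_z f i z).
Proof.
move=> mmu [mx cx] k f bf.
have := @Rexp_prod_ext R _ (borel S) _ Om P (fun=> 1)
  (fun i om g => g (x i om)) (fun i om g => \int[mu om]_z g z) k.
move=> /(_ (bmeas_cst 1)) /(_ (fun i => random_mean_eval (mx i))).
move=> /(_ (fun=> random_mean_pprobability mmu)) H.
under eq_Rintegral do rewrite -[\prod_(i < k) _]mul1r.
under [RHS]eq_Rintegral do rewrite -[\prod_(i < k) _]mul1r.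
apply: H => // A mA.
have := @Rexp_prod_indic _ _ P _ (borel S) setT k x A measurableT mx mA.
under eq_Rintegral do rewrite indicT mul1r.
move=> E; under eq_Rintegral do rewrite mul1r.
rewrite {}E; have := cx setT measurableT k A mA.
rewrite preimage_setT => ->; congr fine; apply: eq_integral => om _.
rewrite mul1r -prodEFin; apply: eq_bigr => i _.
by rewrite Rexp_indic// prob_fineK.
Qed.

Lemma iid_product (lambda0 : probability (borel S) R) (y : nat -> Om -> borel S) :
  iid P lambda0 y -> forall k (f : nat -> borel S -> R),
  (forall i, bmeas (f i)) ->
  \int[P]_om (\prod_(i < k) f i (y i om)) =
  \prod_(i < k) \int[lambda0]_z f i z.
Proof.
move=> [my iy] k f bf.
have := @Rexp_prod_ext R _ (borel S) _ Om P (fun=> 1)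
  (fun i om g => g (y i om)) (fun i om g => \int[lambda0]_z g z) k.
move=> /(_ (bmeas_cst 1)) /(_ (fun i => random_mean_eval (my i))).
have rl : random_mean (fun (om : Om) (g : borel S -> R) => \int[lambda0]_z g z).
  by apply: random_mean_int => A mA; exact: measurable_cst.
move=> /(_ (fun=> rl)) H.
under eq_Rintegral do rewrite -[\prod_(i < k) _]mul1r.
rewrite H// ?Rexp_cst ?mul1r// => A mA.
have := @Rexp_prod_indic _ _ P _ (borel S) setT k y A measurableT my mA.
under eq_Rintegral do rewrite indicT mul1r.
move=> E; under eq_Rintegral do rewrite mul1r.
rewrite {}E setTI iy// Rexp_cst mul1r.
rewrite -[RHS]/(fine (_%:E)) -prodEFin; congr fine; apply: eq_bigr => i _.
by rewrite Rexp_indic// prob_fineK.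
Qed.

(** * Independence of weights and atoms *)

Section independence.
Context (lambda0 : probability (borel S) R) (w : nat -> Om -> R)
  (xi : nat -> Om -> borel S).
Hypothesis mw : forall j, measurable_fun [set: Om] (w j).
Hypothesis mxi : forall j, measurable_fun [set: Om] (xi j).
Hypothesis indep : forall B : set Om, sigma_of w B ->
  forall (k : nat) (A : nat -> set (borel S)), (forall j, measurable (A j)) ->
  P (B `&` \bigcap_(j in `I_k) (xi j @^-1` A j)) =
    (P B * \prod_(j < k) lambda0 (A j))%E.

(** The set [Om] with the coarser sigma-algebra generated by the weights, so that [bmeas] on it
    means bounded and measurable with respect to the weights. *)
Definition sigmaT : measurableType _ := g_sigma_algebraType
  (\bigcup_(j in [set: nat]) [set w j @^-1` E | E in measurable]).

Lemma sub_sigmaT : measurable_fun [set: Om] (id : Om -> sigmaT).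
Proof.
move=> _ B sB; rewrite setTI preimage_id.
apply: (smallest_sub (@sigma_algebra_measurable _ Om)) sB => _ [j _ [E mE <-]].
by rewrite -[X in measurable X]setTI; exact: mw.
Qed.

Lemma measurable_sigmaT_w j : measurable_fun [set: sigmaT] (w j : sigmaT -> R).
Proof.
move=> _ E mE; rewrite setTI; apply: sub_sigma_algebra.
by exists j => //; exists E.
Qed.

(** Two extensions are nested: [bfun_ext] reduces [W] to the indicator of an event of the weights,
    and then [Rexp_prod_ext], with that indicator as weight, reduces the [f i] to indicators. *)
Lemma indep_product (W : Om -> R) k (f : nat -> borel S -> R) :
  bmeas (W : sigmaT -> R) -> (forall i, bmeas (f i)) ->
  \int[P]_om (W om * \prod_(i < k) f i (xi i om)) =
  \int[P]_om W om * \prod_(i < k) \int[lambda0]_z f i z.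
Proof.
move=> bW bf; set c := \prod_(i < k) \int[lambda0]_z f i z.
have bWO : bmeas W by exact: (bmeas_comp sub_sigmaT bW).
rewrite -[RHS]mulrC -RexpZ//; under [RHS]eq_Rintegral do rewrite mulrC.
have bZ : bmeas (fun om => \prod_(i < k) f i (xi i om)).
  by apply: bmeas_prod => i; exact: bmeas_comp.
have b1 := @bfun_weight _ _ P _ sigmaT id _ sub_sigmaT bZ.
have b2 := @bfun_weight _ _ P _ sigmaT id _ sub_sigmaT (bmeas_cst c).
apply: (bfun_ext b1 b2) bW => B sB {W bWO}.
have mB : @measurable _ Om B.
  by have := sub_sigmaT measurableT sB; rewrite setTI preimage_id.
rewrite /c.
have rl : random_mean (fun (om : Om) (g : borel S -> R) => \int[lambda0]_z g z).
  by apply: random_mean_int => A mA; exact: measurable_cst.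
apply: (@Rexp_prod_ext R _ (borel S) _ Om P (\1_B)
  (fun i om g => g (xi i om)) (fun i om g => \int[lambda0]_z g z) k) => //.
- exact: bmeas_indic.
- by move=> i; exact: random_mean_eval.
move=> A mA; rewrite Rexp_prod_indic// indep//.
under eq_Rintegral do rewrite mulrC; rewrite RexpZ; last exact: bmeas_indic.
rewrite Rexp_indic// mulrC -[RHS]/(fine (_%:E)); congr fine.
rewrite EFinM prob_fineK// -prodEFin; congr (_ * _)%E; apply: eq_bigr => i _.
by rewrite Rexp_indic// prob_fineK.
Qed.

Lemma indep_product1 (W : Om -> R) i (g : borel S -> R) :
  bmeas (W : sigmaT -> R) -> bmeas g ->
  \int[P]_om (W om * g (xi i om)) = \int[P]_om W om * \int[lambda0]_z g z.
Proof.
move=> bW bg; pose f l := if l == i then g else (fun=> 1).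
have bf l : bmeas (f l) by rewrite /f; case: eqP => // _; exact: bmeas_cst.
have fi : f i = g by rewrite /f eqxx.
have flt (l : 'I_i) : f l = (fun=> 1) by rewrite /f ltn_eqF.
have := indep_product i.+1 bW bf; rewrite big_ord_recr/= fi.
rewrite big1; last by move=> l _; rewrite flt Rexp_cst.
rewrite mul1r => <-; apply: eq_Rintegral => om _.
by rewrite big_ord_recr/= fi big1 ?mul1r// => l _; rewrite flt.
Qed.

Lemma indep_product2 (W : Om -> R) i j (g h : borel S -> R) : (i < j)%N ->
  bmeas (W : sigmaT -> R) -> bmeas g -> bmeas h ->
  \int[P]_om (W om * (g (xi i om) * h (xi j om))) =
  \int[P]_om W om * (\int[lambda0]_z g z * \int[lambda0]_z h z).
Proof.
move=> ij bW bg bh.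
pose f l := if l == j then h else if l == i then g else (fun=> 1).
have bf l : bmeas (f l).
  by rewrite /f; case: eqP => // _; case: eqP => // _; exact: bmeas_cst.
have fj : f j = h by rewrite /f eqxx.
have fi : f i = g by rewrite /f ltn_eqF// eqxx.
have flt (l : 'I_j) : l != Ordinal ij -> f l = (fun=> 1).
  by rewrite -val_eqE/= => /negbTE li; rewrite /f ltn_eqF// li.
have := indep_product j.+1 bW bf; rewrite big_ord_recr/= fj.
rewrite (bigD1 (Ordinal ij))//= fi big1; last first.
  by move=> l /flt E; rewrite E Rexp_cst.
rewrite mulr1 => <-; apply: eq_Rintegral => om _.
rewrite big_ord_recr/= fj (bigD1 (Ordinal ij))//= fi big1 ?mulr1//.
by move=> l /flt ->.
Qed.

End independence.
End species.
End ProductFormulas.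

(** * Integration against a species sampling mixture *)

Section Mixtures.
Context {R : realType}.

Lemma nneseries_fin_cvg (a : nat -> R) (r : R) : (forall j, 0 <= a j) ->
  (\sum_(j <oo) (a j)%:E = r%:E)%E ->
  \sum_(j < N) a j @[N --> \oo] --> r.
Proof.
move=> a0 ar.
have : (\sum_(0 <= j < N) (a j)%:E)%E @[N --> \oo] --> r%:E.
  rewrite -ar; apply: is_cvg_nneseries => j _ _.
  by rewrite lee_fin.
under eq_cvg do rewrite sumEFin big_mkord.
by move=> /fine_cvg.
Qed.

Context {d} {T : measurableType d}.
Variables (m lam : probability T R) (w : nat -> R) (xi : nat -> T).
Hypothesis w_ge0 : forall j, 0 <= w j.
Hypothesis w_le1 : (\sum_(j <oo) (w j)%:E <= 1)%E.
Hypothesis mE : forall A, measurable A -> m A =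
  (\sum_(j <oo) ((w j)%:E * \d_(xi j) A)
    + (1%:E - \sum_(j <oo) (w j)%:E) * lam A)%E.

Lemma sum_weights_le1 N : \sum_(j < N) w j <= 1.
Proof.
rewrite -lee_fin; apply: le_trans w_le1.
rewrite -sumEFin -(big_mkord xpredT (fun j => (w j)%:E)).
by apply: nneseries_lim_ge => j _ _; rewrite lee_fin.
Qed.

Lemma weight_le1 j : w j <= 1.
Proof.
apply: le_trans (sum_weights_le1 j.+1); rewrite big_ord_recr/= lerDr.
exact: sumr_ge0.
Qed.

Let s : R := fine (\sum_(j <oo) (w j)%:E)%E.

Let sE : (\sum_(j <oo) (w j)%:E)%E = s%:E.
Proof.
rewrite fineK// ge0_fin_numE; first exact: le_lt_trans w_le1 (ltry _).
by apply: nneseries_ge0 => j _ _; rewrite lee_fin.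
Qed.

Let s1 : 0 <= 1 - s.
Proof. by rewrite subr_ge0 -lee_fin -sE. Qed.

Lemma mixture_integral (h : T -> R) : bmeas h -> (forall z, 0 <= h z) ->
  ((\int[m]_z h z)%:E =
   \sum_(j <oo) (w j * h (xi j))%:E + ((1 - s) * \int[lam]_z h z)%:E)%E.
Proof.
move=> bh h0; rewrite EFin_Rexp//.
have mh : measurable_fun [set: T] (EFin \o h) by apply/measurable_EFinP; case: bh.
have h0' z : [set: T] z -> (0 <= (EFin \o h) z)%E by rewrite lee_fin.
pose md j : {measure set T -> \bar R} := mscale (NngNum (w_ge0 j)) (\d_(xi j)).
(* The mixture is rebuilt as a series of scaled Dirac measures plus a scaled [lam], so that the
   integral of a nonnegative function distributes over it. *)
pose m2 : {measure set T -> \bar R} :=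
  measure_add (mseries md 0) (mscale (NngNum s1) lam).
rewrite (eq_measure_integral m2) => [|A mA _]; last first.
  by rewrite [LHS]mE// [RHS]measure_addE sE -EFinB.
rewrite ge0_integral_measure_add// ge0_integral_measure_series//.
rewrite ge0_integral_mscale//= EFinM EFin_Rexp//; congr (_ + _)%E.
apply: eq_eseriesr => j _; rewrite ge0_integral_mscale//= integral_dirac//.
by rewrite diracT mul1e EFinM.
Qed.

Lemma mixture_partial_cvg (f : T -> R) : bmeas f ->
  \sum_(j < N) (w j * (f (xi j) - \int[lam]_z f z)) @[N --> \oo] -->
  \int[m]_z f z - \int[lam]_z f z.
Proof.
move=> bf; have [M M0 fM] := bmeas_ge0_bound bf.
(* The shift makes the integrand nonnegative, as [mixture_integral] requires. It cancels in the
   difference of means because [m] and [lam] both have mass 1. *)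
pose h z := f z + M.
have bh : bmeas h by exact/bmeasD/bmeas_cst.
have h0 z : 0 <= h z by have /ler_normlP[] := fM z; rewrite /h; lra.
have hE (p : probability T R) : \int[p]_z h z = \int[p]_z f z + M.
  by rewrite RexpD ?Rexp_cst//; exact: bmeas_cst.
have cw : \sum_(j < N) w j @[N --> \oo] --> s by exact: nneseries_fin_cvg sE.
have ch : \sum_(j < N) (w j * h (xi j)) @[N --> \oo] -->
    \int[m]_z h z - (1 - s) * \int[lam]_z h z.
  apply: (@nneseries_fin_cvg (fun j => w j * h (xi j))) => [j|].
    by rewrite mulr_ge0.
  rewrite EFinB mixture_integral// addeK//.
rewrite (_ : _ - _ = \int[m]_z h z - (1 - s) * \int[lam]_z h z
    - \int[lam]_z h z * s); last by rewrite !hE; ring.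
rewrite (_ : (fun N => _) = (fun N => \sum_(j < N) (w j * h (xi j)) -
    \int[lam]_z h z * \sum_(j < N) w j)).
  by apply: cvgB => //; apply: cvgM => //; exact: cvg_cst.
apply/funext => N; rewrite mulr_sumr -sumrB; apply: eq_bigr => j _.
by rewrite hE /h; ring.
Qed.

Lemma mixture_partial_bound (g : T -> R) (c : R) N : (forall z, `|g z| <= c) ->
  `|\sum_(j < N) (w j * g (xi j))| <= c.
Proof.
move=> gc; apply: le_trans (ler_norm_sum _ _ _) _.
have c0 : 0 <= c by exact: le_trans (gc (xi 0)).
apply: (@le_trans _ _ (\sum_(j < N) w j * c)).
  by apply: ler_sum => j _; rewrite normrM ger0_norm// ler_wpM2l.
by rewrite -mulr_suml ler_piMl// sum_weights_le1.
Qed.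

End Mixtures.

(** * First two moments *)

Section SpeciesMoments.
Context {R : realType} {S : ptopologicalType} {dO} {Om : measurableType dO}
  (P : probability Om R).

Lemma species_moments (lambda0 : probability (borel S) R) (rho : R)
    (mu : Om -> probability (borel S) R) (f : borel S -> R) :
  species_sampling P lambda0 rho mu -> bmeas f ->
  \int[P]_om (\int[mu om]_z f z) = \int[lambda0]_z f z /\
  \int[P]_om ((\int[mu om]_z f z - \int[lambda0]_z f z) ^+ 2) =
    rho * \int[lambda0]_z ((f z - \int[lambda0]_t f t) ^+ 2).
Proof.
move=> [mmu [w [xi [mw mxi indep aemu tie]]]] bf.
set a := \int[lambda0]_z f z; pose g z := f z - a.
have bg : bmeas g by exact/bmeasB/bmeas_cst.
have g_center : \int[lambda0]_z g z = 0.
  by rewrite RexpB ?Rexp_cst ?subrr//; exact: bmeas_cst.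
have bg2 : bmeas (fun z => g z ^+ 2) by exact: bmeasM.
set v := \int[lambda0]_z (g z ^+ 2).
(* The weights lie in [[0, 1]] only almost surely. Truncation makes them bounded everywhere and, as
   it acts on each [w j] alone, keeps them measurable with respect to the weights. *)
pose w' j om : R := Num.min (Num.max (w j om) 0) 1.
have w'01 j om : 0 <= w' j om <= 1.
  by rewrite /w' le_min le_max lexx orbT ler01/= ge_min lexx orbT.
have bw' j : bmeas (w' j : sigmaT w -> R).
  split; last first.
    by exists 1 => om; have /andP[? ?] := w'01 j om; rewrite ger0_norm.
  apply: measurable_minr; last exact: measurable_cst.
  apply: measurable_maxr; last exact: measurable_cst.
  exact: measurable_sigmaT_w.
have bw'O j : bmeas (w' j : Om -> R) by exact: (bmeas_comp (sub_sigmaT mw) (bw' j)).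
have bgx j : bmeas (fun om => g (xi j om)) by exact: bmeas_comp.
have w'E : {ae P, forall om j, w' j om = w j om}.
  apply: filterS aemu => om [w0 w1 _] j.
  rewrite /w' (max_idPl (w0 j)); apply/min_idPl.
  exact: (@weight_le1 _ (w ^~ om)).
pose Y N om := \sum_(j < N) (w' j om * g (xi j om)).
have bY N : bmeas (Y N) by apply: bmeas_sum => j; exact: bmeasM.
have EY N : \int[P]_om Y N om = 0.
  rewrite Rexp_sum; last by move=> j; exact: bmeasM.
  apply: big1 => j _.
  by rewrite (indep_product1 mw mxi indep j (bw' j) bg) g_center mulr0.
have EY2 N : \int[P]_om (Y N om ^+ 2) =
    (\sum_(j < N) \int[P]_om (w' j om ^+ 2)) * v.
  elim: N => [|N IH].
    rewrite big_ord0 mul0r -[RHS](Rexp_cst P); apply: eq_Rintegral => om _.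
    by rewrite /Y big_ord0 expr0n.
  (* The cross terms of the new summand with the earlier ones. They have mean 0: the atoms are
     distinct and independent of the weights, and [g] has mean 0 under [lambda0]. *)
  pose C om := \sum_(i < N) (w' i om * w' N om * (g (xi i om) * g (xi N om))).
  have bC : bmeas C by apply: bmeas_sum => i; do !apply: bmeasM.
  have EC : \int[P]_om C om = 0.
    rewrite Rexp_sum; last by move=> i; do !apply: bmeasM.
    apply: big1 => i _.
    have bww : bmeas ((fun om => w' i om * w' N om) : sigmaT w -> R) by exact: bmeasM.
    have -> := indep_product2 mw mxi indep (ltn_ord i) bww bg bg.
    by rewrite g_center mulr0 mulr0.
  have E om : Y N.+1 om ^+ 2 =
      Y N om ^+ 2 + 2 * C om + w' N om ^+ 2 * g (xi N om) ^+ 2.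
    rewrite /Y big_ord_recr/= /C sqrrD exprMn mulr_suml -mulr_natl.
    by congr (_ + 2 * _ + _); apply: eq_bigr => i _; rewrite mulrACA.
  have bwN : bmeas ((fun om => w' N om ^+ 2) : sigmaT w -> R) by exact: bmeasM.
  have bwNO : bmeas (fun om => w' N om ^+ 2) by exact: bmeasM.
  have bl : bmeas (fun om => w' N om ^+ 2 * g (xi N om) ^+ 2).
    by apply: bmeasM => //; exact: bmeasM.
  have bYN : bmeas (fun om => Y N om ^+ 2) by exact: bmeasM.
  transitivity (\int[P]_om (Y N om ^+ 2 + 2 * C om + w' N om ^+ 2 * g (xi N om) ^+ 2)).
    by apply: eq_Rintegral => om _; exact: E.
  rewrite (RexpD P (bmeasD bYN (bmeasZ 2 bC)) bl) (RexpD P bYN (bmeasZ 2 bC)).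
  rewrite (RexpZ P 2 bC) EC mulr0 addr0 IH.
  have -> := indep_product1 mw mxi indep N bwN bg2.
  by rewrite big_ord_recr/= mulrDl.
have bmuf : bmeas (fun om => \int[mu om]_z f z).
  exact: (bmeas_random_mean (random_mean_pprobability mmu) bf).
have bmufa : bmeas (fun om => \int[mu om]_z f z - a) by exact/bmeasB/bmeas_cst.
have Ycvg : {ae P, forall om, Y N om @[N --> \oo] --> \int[mu om]_z f z - a}.
  apply: filterS2 w'E aemu => om wE [w0 w1 mE].
  rewrite (_ : (fun N => _) = fun N => \sum_(j < N) (w j om * (f (xi j om) - a))).
    exact: (@mixture_partial_cvg _ _ _ (mu om) lambda0 (w ^~ om) (xi ^~ om)).
  by apply/funext => N; apply: eq_bigr => j _; rewrite wE.
have [c c0 gc] := bmeas_ge0_bound bg.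
have Ybound : {ae P, forall om N, `|Y N om| <= c}.
  apply: filterS2 w'E aemu => om wE [w0 w1 _] N.
  rewrite /Y; under eq_bigr do rewrite wE.
  exact: (@mixture_partial_bound _ _ _ (w ^~ om) (xi ^~ om)).
split.
  have h1 := Rexp_bounded_cvg bY bmufa Ybound Ycvg.
  have h2 : \int[P]_om Y N om @[N --> \oo] --> (0 : R).
    by under eq_cvg do rewrite EY; exact: cvg_cst.
  (* The means of [Y N] are all 0 and also converge to the mean of the centred integral; limits are
     unique. *)
  apply: subr0_eq; rewrite -(cvg_lim (@Rhausdorff R) h2).
  rewrite (cvg_lim (@Rhausdorff R) h1) RexpB ?Rexp_cst//; exact: bmeas_cst.
have h1 : \int[P]_om (Y N om ^+ 2) @[N --> \oo] -->
    \int[P]_om ((\int[mu om]_z f z - a) ^+ 2).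
  apply: (@Rexp_bounded_cvg _ _ _ _ _ _ (c ^+ 2)).
  - by move=> N; exact: bmeasM.
  - exact: bmeasM.
  - by apply: filterS Ybound => om Yc N; rewrite normrX lerXn2r// nnegrE.
  - by apply: filterS Ycvg => om Yc; apply: cvgM.
have h2 : \int[P]_om (Y N om ^+ 2) @[N --> \oo] --> rho * v.
  under eq_cvg do rewrite EY2.
  apply: cvgM; last exact: cvg_cst.
  apply: (@nneseries_fin_cvg _ (fun j => \int[P]_om (w' j om ^+ 2))) => [j|].
    by apply: Rintegral_ge0 => om _; rewrite sqr_ge0.
  rewrite -tie; apply: eq_eseriesr => j _.
  rewrite EFin_Rexp; last exact: bmeasM.
  apply: ae_eq_integral => //.
  - by apply/measurable_EFinP; have [] := bmeasM (bw'O j) (bw'O j).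
  - by apply/measurable_EFinP; exact: measurable_funX.
  - by apply: filterS w'E => om + _ => /(_ j) ->.
by rewrite -(cvg_lim (@Rhausdorff R) h1) (cvg_lim (@Rhausdorff R) h2).
Qed.

End SpeciesMoments.

(** * Convergence in mean *)

Section Limits.
Context {R : realType}.

(** Continuity, uniform for [a] in the compact segment, handles [|a - b| < d]; otherwise the
    oscillation is at most [2 * B], which [(2 * B / d ^+ 2) * (a - b) ^+ 2] dominates. No bound on
    [b] is required. *)
Lemma quadratic_modulus (F : R -> R) (C : R) (e : R) :
  bounded_continuous F -> 0 < e ->
  exists2 K : R, 0 <= K & forall a b, `|a| <= C ->
    `|F a - F b| <= e + K * (a - b) ^+ 2.
Proof.
move=> [cF [B FB]] e0.
have B0 : 0 <= B by exact: le_trans (FB 0).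
have := @segment_compact R (- C) C; rewrite compact_near_coveringP.
move=> /(_ R (0 : R)^'+ (fun d a => forall b, `|a - b| < d -> `|F a - F b| <= e)) H.
have /H{}H : forall a : R, `[- C, C]%classic a -> \forall a' \near a & d \near (0 : R)^'+,
    forall b, `|a' - b| < d -> `|F a' - F b| <= e.
  move=> a _; have e20 : 0 < e / 2 by rewrite divr_gt0.
  have /cvgrPdist_le /(_ _ e20) /nbhs_ballP[r /= r0 ar] := cF a.
  have r20 : 0 < r / 2 by rewrite divr_gt0.
  (* Halving the radius leaves room for [b]: it is within [r / 2] of [a'], itself within [r / 2] of
     [a]. *)
  exists (ball a (r / 2), [set d | d < r / 2]) => /=.
    by split; [exact: nbhsx_ballx|exact: nbhs_right_lt].
  move=> [a' d] /= [aa' dr] b a'b.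
  have /ar h1 : ball a r a' by apply: le_ball aa'; lra.
  have /ar h2 : ball a r b.
    rewrite /ball/= -(subrKA a').
    apply: le_lt_trans (ler_normD _ _) _; move: aa' dr a'b; rewrite /ball/=; lra.
  rewrite -(subrKA (F a)); apply: le_trans (ler_normD _ _) _.
  by move: h1 h2 => /=; rewrite (distrC (F a) (F a')); lra.
have [d [d0 dP]] : exists d : R, 0 < d /\ forall a, `[- C, C]%classic a ->
    forall b, `|a - b| < d -> `|F a - F b| <= e.
  apply: (@filter_ex _ ((0 : R)^'+)); near=> d; split.
    by near: d; exact: nbhs_right_gt.
  by near: d.
have B20 : 0 <= 2 * B by exact: mulr_ge0.
have K0 : 0 <= 2 * B / d ^+ 2 by rewrite divr_ge0// sqr_ge0.
exists (2 * B / d ^+ 2) => // a b aC.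
have Kab0 : 0 <= 2 * B / d ^+ 2 * (a - b) ^+ 2 by rewrite mulr_ge0// sqr_ge0.
have [abd|dab] := ltP `|a - b| d.
  apply: le_trans (dP _ _ _ abd) _; last by rewrite lerDl.
  by rewrite /= in_itv/= -ler_norml.
apply: (@le_trans _ _ (2 * B)).
  apply: le_trans (ler_normB _ _) _; have h1 := FB a; have h2 := FB b.
  by rewrite mulr_natl mulr2n lerD.
rewrite (@le_trans _ _ (2 * B / d ^+ 2 * (a - b) ^+ 2))//; last by rewrite lerDr ltW.
rewrite mulrAC ler_pdivlMr ?exprn_gt0//; apply: ler_wpM2l => //.
by rewrite -(real_normK (num_real (a - b))) lerXn2r// nnegrE ltW.
Unshelve. all: by end_near. Qed.

Section mean_convergence.
Context {dO : nat -> measure_display} {Om : forall n, measurableType (dO n)}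
  (P : forall n, probability (Om n) R).

Definition mean_cvg0 (Z : forall n, Om n -> R) : Prop :=
  \int[P n]_om `|Z n om| @[n --> \oo] --> 0.

Lemma mean_cvg0_dominated (Z T : forall n, Om n -> R) :
  (forall n, bmeas (Z n)) -> (forall n, bmeas (T n)) ->
  (forall e, 0 < e -> exists2 K : R, 0 <= K & forall n om,
    `|Z n om| <= e + K * T n om) ->
  \int[P n]_om T n om @[n --> \oo] --> 0 -> mean_cvg0 Z.
Proof.
move=> bZ bT ZT /cvgrPdist_le T0; apply/cvgrPdist_le => e e0.
have e20 : 0 < e / 2 by rewrite divr_gt0.
have [K K0 ZK] := ZT _ e20.
(* [K + 1] rather than [K] allows [K = 0]. *)
have := T0 (e / 2 / (K + 1)).
rewrite divr_gt0 ?ltr_wpDl// => /(_ isT); apply: filterS => n.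
rewrite !sub0r !normrN => Tn.
rewrite ger0_norm; last exact: Rintegral_ge0.
apply: (@le_trans _ _ (\int[P n]_om (e / 2 + K * T n om))).
  apply: le_Rexp (ZK n); first exact: bmeas_norm.
  by apply: bmeasD; [exact: bmeas_cst|exact: bmeasZ].
rewrite RexpD ?Rexp_cst ?RexpZ//; [|exact: bmeas_cst|exact: bmeasZ].
suff : K * \int[P n]_om T n om <= e / 2 by lra.
apply: le_trans (ler_wpM2l K0 (le_trans (ler_norm _) Tn)) _.
rewrite mulrA ler_pdivrMr ?ltr_wpDl//; have := ltW e20; nra.
Qed.

Lemma mean_cvg0D (Z Z' T : forall n, Om n -> R) :
  (forall n, bmeas (Z n)) -> (forall n, bmeas (Z' n)) ->
  (forall n, bmeas (T n)) ->
  (forall n om, `|T n om| <= `|Z n om| + `|Z' n om|) ->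
  mean_cvg0 Z -> mean_cvg0 Z' -> mean_cvg0 T.
Proof.
move=> bZ bZ' bT TZ cZ cZ'.
apply: (@squeeze_cvgr _ _ _ _ (fun=> 0)
  (fun n => \int[P n]_om `|Z n om| + \int[P n]_om `|Z' n om|)).
- apply: nearW => n; apply/andP; split; first exact: Rintegral_ge0.
  rewrite -RexpD; [|exact: bmeas_norm|exact: bmeas_norm].
  by apply: le_Rexp => //; [exact: bmeas_norm|apply: bmeasD; exact: bmeas_norm].
- exact: cvg_cst.
- by rewrite -(addr0 0); exact: cvgD.
Qed.

Lemma mean_cvg0_cvg (Z Z' : forall n, Om n -> R) (l : R) :
  (forall n, bmeas (Z n)) -> (forall n, bmeas (Z' n)) ->
  mean_cvg0 (fun n om => Z n om - Z' n om) ->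
  \int[P n]_om Z' n om @[n --> \oo] --> l ->
  \int[P n]_om Z n om @[n --> \oo] --> l.
Proof.
move=> bZ bZ' ZZ' cZ'.
have bB n : bmeas (fun om => Z n om - Z' n om) by exact: bmeasB.
have c0 : \int[P n]_om (Z n om - Z' n om) @[n --> \oo] --> (0 : R).
  apply/norm_cvg0P; apply: (@squeeze_cvgr _ _ _ _ (fun=> 0)
    (fun n => \int[P n]_om `|Z n om - Z' n om|)) => //.
    apply: nearW => n; rewrite normr_ge0/=.
    exact: le_normr_Rintegral (bmeas_integrable (P n) (bB n)).
  exact: cvg_cst.
rewrite (_ : (fun n => _) = fun n => \int[P n]_om Z' n om +
    \int[P n]_om (Z n om - Z' n om)); last first.
  by apply/funext => n; rewrite RexpB// addrC subrK.
by rewrite -(addr0 l); exact: cvgD.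
Qed.

End mean_convergence.
End Limits.

(** * The limits of vanishing and full ties *)

Lemma bounded_continuous_bound {R : realType} {S : ptopologicalType}
    (f : S -> R) : bounded_continuous f -> exists2 C : R, 0 <= C & forall z, `|f z| <= C.
Proof. by move=> /bmeas_borel_continuous/bmeas_ge0_bound. Qed.

Lemma bounded_continuousM {R : realType} {S : ptopologicalType} (f g : S -> R) :
  bounded_continuous f -> bounded_continuous g ->
  bounded_continuous (fun z => f z * g z).
Proof.
move=> [cf [M fM]] [cg [N gN]]; split.
  by move=> z; apply: cvgM; [exact: cf|exact: cg].
by exists (M * N) => z; rewrite normrM ler_pM.
Qed.

Lemma bounded_continuous_prod {R : realType} {S : ptopologicalType} K
    (f : nat -> S -> R) : (forall i, bounded_continuous (f i)) ->
  bounded_continuous (fun z => \prod_(i < K) f i z).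
Proof.
move=> bf; elim: K => [|K IH].
  under eq_fun do rewrite big_ord0; split; first by move=> z; exact: cvg_cst.
  by exists 1 => z; rewrite normr1.
by under eq_fun do rewrite big_ord_recr/=; exact: bounded_continuousM.
Qed.

Lemma Rexp_var {R : realType} {d} {T : measurableType d} (p : probability T R)
    (f : T -> R) : bmeas f ->
  \int[p]_z ((f z - \int[p]_t f t) ^+ 2) =
  \int[p]_z (f z ^+ 2) - (\int[p]_t f t) ^+ 2.
Proof.
move=> bf; set a := \int[p]_t f t.
have bf2 : bmeas (fun z => f z ^+ 2) by exact: bmeas_sqr.
transitivity (\int[p]_z (f z ^+ 2 - 2 * a * f z + a ^+ 2)).
  by apply: eq_Rintegral => z _; ring.
have ba := bmeas_cst (T := T) (a ^+ 2).
rewrite (RexpD p (bmeasB bf2 (bmeasZ (2 * a) bf)) ba).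
rewrite (RexpB p bf2 (bmeasZ (2 * a) bf)) (RexpZ p _ bf) Rexp_cst -/a.
ring.
Qed.

Lemma Rexp_dirac {R : realType} {d} {T : measurableType d} (f : T -> R) (x : T) :
  bmeas f -> \int[\d_x]_z f z = f x.
Proof.
move=> [mf _]; rewrite /Rintegral integral_dirac//; last exact/measurable_EFinP.
by rewrite diracT mul1e.
Qed.

(** The quadratic modulus of the identity, with explicit constant: it passes from convergence of
    second moments to convergence in mean without Cauchy-Schwarz. *)
Lemma normr_le_sqr {R : realFieldType} (e t : R) : 0 < e ->
  `|t| <= e + e^-1 * t ^+ 2.
Proof.
move=> e0; rewrite -(real_normK (num_real t)).
have t0 : 0 <= e^-1 * `|t| ^+ 2 by apply: mulr_ge0; rewrite ?sqr_ge0 ?invr_ge0 ?ltW.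
have [te|et] := leP `|t| e; first by rewrite (le_trans te)// lerDl.
apply: (@le_trans _ _ (e^-1 * `|t| ^+ 2)); last by rewrite lerDr ltW.
by rewrite mulrC ler_pdivlMr// expr2 ler_wpM2l// ltW.
Qed.

Lemma Rexp01 {R : realType} {d} {T : measurableType d} (p : probability T R)
    (f : T -> R) : bmeas f -> (forall z, 0 <= f z <= 1) ->
  0 <= \int[p]_z f z <= 1.
Proof.
move=> bf f01; apply/andP; split.
  by apply: Rintegral_ge0 => z _; have /andP[] := f01 z.
rewrite -[leRHS](Rexp_cst p); apply: le_Rexp => // [|z]; first exact: bmeas_cst.
by have /andP[] := f01 z.
Qed.

Section SpeciesLimits.
Context {R : realType} {S : completePseudoMetricType R}.
Context (mu0 : probability (borel S) R) (mu0n : nat -> probability (borel S) R)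
  (rho : nat -> R) (dO : nat -> measure_display)
  (Om : forall n, measurableType (dO n)) (P : forall n, probability (Om n) R)
  (mu : forall n, Om n -> probability (borel S) R).
Arguments mu : clear implicits.
Hypothesis base_cvg : weak_cvg mu0n mu0.
Hypothesis rho01 : forall n, 0 < rho n < 1.
Hypothesis smu : forall n, species_sampling (P n) (mu0n n) (rho n) (mu n).

Let bmu n (f : borel S -> R) : bmeas f -> bmeas (fun om => \int[mu n om]_z f z).
Proof.
have [mmu _] := smu n.
exact: (bmeas_random_mean (random_mean_pprobability mmu)).
Qed.

Let bbc (f : S -> R) : bounded_continuous f -> bmeas (f : borel S -> R).
Proof. exact: bmeas_borel_continuous. Qed.

Let unit_bc (f : S -> R) : unit_continuous f -> bounded_continuous f.
Proof.
move=> [cf f01]; split => //; exists 1 => z.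
by have /andP[? ?] := f01 z; rewrite ger0_norm.
Qed.

Let mean_mu n (f : borel S -> R) : bmeas f ->
  \int[P n]_om (\int[mu n om]_z f z) = \int[mu0n n]_z f z.
Proof. by move=> bf; have [] := species_moments (smu n) bf. Qed.

Let var_bound (p : probability (borel S) R) (f : borel S -> R) (C : R) :
  bmeas f -> (forall z, `|f z| <= C) ->
  0 <= \int[p]_z ((f z - \int[p]_t f t) ^+ 2) <= C ^+ 2.
Proof.
move=> bf fC; apply/andP; split.
  by apply: Rintegral_ge0 => z _; exact: sqr_ge0.
rewrite Rexp_var// lerBlDr; apply: (@le_trans _ _ (C ^+ 2)).
  rewrite -[leRHS](Rexp_cst p); apply: le_Rexp => [||z]; first exact: bmeasM.
    exact: bmeas_cst.
  have C0 : 0 <= C by exact: le_trans (fC z).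
  by rewrite -(real_normK (num_real (f z))) lerXn2r// nnegrE.
by rewrite lerDl sqr_ge0.
Qed.

Section vanishing_ties.
Hypothesis rho0 : rho n @[n --> \oo] --> (0 : R).

(** Splitting around the mean [a n] leaves the variance [rho n * V n] plus the squared bias
    [(a n - m) ^+ 2]. The variances [V n] are bounded by [C ^+ 2] uniformly in [n], and the bias
    vanishes by weak convergence of the bases. *)
Let L2_cvg (f : S -> R) : bounded_continuous f ->
  \int[P n]_om ((\int[mu n om]_z f z - \int[mu0]_z f z) ^+ 2) @[n --> \oo] --> (0 : R).
Proof.
move=> cf; have bf := bbc cf; have [C C0 fC] := bmeas_ge0_bound bf.
pose a n := \int[mu0n n]_z f z; pose m := \int[mu0]_z f z.
pose V n := \int[mu0n n]_z ((f z - a n) ^+ 2).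
have E n : \int[P n]_om ((\int[mu n om]_z f z - m) ^+ 2) =
    rho n * V n + (a n - m) ^+ 2.
  have [E1 E2] := species_moments (smu n) bf.
  rewrite -E2 -/(a n).
  have bd c : bmeas (fun om => \int[mu n om]_z f z - c).
    by apply: bmeasB; [exact: bmu|exact: bmeas_cst].
  have bs : bmeas (fun om => (\int[mu n om]_z f z - a n) ^+ 2) by exact: bmeas_sqr.
  have bl := bmeasZ (2 * (a n - m)) (bd (a n)).
  have bc := bmeas_cst (T := Om n) ((a n - m) ^+ 2).
  transitivity (\int[P n]_om ((\int[mu n om]_z f z - a n) ^+ 2 +
      2 * (a n - m) * (\int[mu n om]_z f z - a n) + (a n - m) ^+ 2)).
    by apply: eq_Rintegral => om _; ring.
  rewrite (RexpD (P n) (bmeasD bs bl) bc) (RexpD (P n) bs bl) Rexp_cst.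
  rewrite (RexpZ (P n) _ (bd (a n))).
  rewrite (RexpB (P n) (bmu n bf) (bmeas_cst (a n))) Rexp_cst E1 /a subrr.
  by rewrite mulr0 addr0.
have h1 : rho n * V n @[n --> \oo] --> (0 : R).
  apply: (@squeeze_cvgr _ _ _ _ (fun=> 0) (fun n => rho n * C ^+ 2)).
  - apply: nearW => n; have /andP[V0 VC] := var_bound (mu0n n) bf fC.
    have /andP[r0 _] := rho01 n.
    by apply/andP; split; [exact: mulr_ge0 (ltW r0) V0|exact: ler_wpM2l (ltW r0) _ _ VC].
  - exact: cvg_cst.
  - by rewrite -(mul0r (C ^+ 2)); apply: cvgM => //; exact: cvg_cst.
have am : a n - m @[n --> \oo] --> (0 : R).
  by rewrite -(subrr m); apply: cvgB; [exact: base_cvg|exact: cvg_cst].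
under eq_cvg do rewrite E.
have := cvgD h1 (cvgM am am); rewrite mulr0 addr0; exact.
Qed.

Lemma weak_cvg_dist_vanishing_ties :
  weak_cvg_dist P mu mu0 (fun _ : borel S => mu0).
Proof.
move=> f cf F bF; have [C C0 fC] := bounded_continuous_bound cf.
rewrite Rexp_cst.
have bFc := @bmeas_borel_continuous R R F bF.
have bFmu n : bmeas (fun om => F (\int[mu n om]_z f z)).
  split; last by have [_ [B FB]] := bF; exists B.
  apply: measurableT_comp; last by have [] := bmu n (bbc cf).
  by apply: continuous_measurable_fun; case: bF.
apply: (mean_cvg0_cvg (Z' := fun n om => F (\int[mu0]_z f z))) => //.
- by move=> n; exact: bmeas_cst.
- apply: mean_cvg0_dominated (L2_cvg cf).
  + by move=> n; apply: bmeasB => //; exact: bmeas_cst.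
  + by move=> n; apply: bmeas_sqr; apply: bmeasB; [exact/bmu/bbc|exact: bmeas_cst].
  + move=> e e0; have [K K0 KF] := quadratic_modulus C bF e0.
    by exists K => // n om; apply: KF; apply: Rexp_bound => //; exact: bbc.
- by under eq_cvg do rewrite Rexp_cst; exact: cvg_cst.
Qed.

Lemma product_cvg_vanishing_ties K (f : nat -> S -> R) :
  (forall i, unit_continuous (f i)) ->
  \int[P n]_om (\prod_(i < K) \int[mu n om]_z f i z) @[n --> \oo] -->
  \prod_(i < K) \int[mu0]_z f i z.
Proof.
move=> cf; have bf i := bbc (unit_bc (cf i)).
have b01 i (p : probability (borel S) R) : 0 <= \int[p]_z f i z <= 1.
  by apply: Rexp01; [exact: bf|have [] := cf i].
have bprod n k : bmeas (fun om => \prod_(i < k) \int[mu n om]_z f i z).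
  by apply: bmeas_prod => i; exact: bmu.
have bcst n (c : R) := bmeas_cst (T := Om n) c.
apply: (mean_cvg0_cvg (Z' := fun n om => \prod_(i < K) \int[mu0]_z f i z)) => //;
  last first.
  by under eq_cvg do rewrite Rexp_cst; exact: cvg_cst.
elim: K => [|K IH].
  rewrite /mean_cvg0 (_ : (fun n => _) = fun=> 0); first exact: cvg_cst.
  apply/funext => n; rewrite -[RHS](Rexp_cst (P n)); apply: eq_Rintegral => om _.
  by rewrite !big_ord0 subrr normr0.
have bD n : bmeas (fun om => \int[mu n om]_z f K z - \int[mu0]_z f K z).
  by apply: bmeasB => //; exact: bmu.
apply: (mean_cvg0D _ bD _ _ IH) => [n|n|n om|]; try exact: bmeasB.
- rewrite !big_ord_recr/=; set A := \prod_(i < K) _; set B := \prod_(i < K) _.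
  set c := \int[mu n om]_z f K z; set m := \int[mu0]_z f K z.
  (* Telescoping: the first term is the induction hypothesis times a factor in [[0, 1]], the second
     is one new factor, controlled by [L2_cvg]. *)
  have -> : A * c - B * m = (A - B) * c + B * (c - m) by ring.
  apply: le_trans (ler_normD _ _) _; rewrite !normrM lerD//.
    by rewrite ler_piMr//; have /andP[? ?] := b01 K (mu n om); rewrite ger0_norm.
  rewrite ler_piMl// normr_prod prodr_ile1// => i _; rewrite normr_ge0/=.
  by have /andP[? ?] := b01 i mu0; rewrite ger0_norm.
- apply: mean_cvg0_dominated (L2_cvg (unit_bc (cf K))) => // [n|e e0].
    exact: bmeasM.
  exists e^-1; first by rewrite invr_ge0 ltW.
  by move=> n om; exact: normr_le_sqr.
Qed.

End vanishing_ties.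

Section full_ties.
Hypothesis rho1 : rho n @[n --> \oo] --> (1 : R).

Let bvar n (f : S -> R) : bounded_continuous f ->
  bmeas (fun om => \int[mu n om]_z ((f z - \int[mu n om]_t f t) ^+ 2)).
Proof.
move=> cf; have bf := bbc cf; under eq_fun do rewrite Rexp_var//.
have bf2 : bmeas (fun z : borel S => f z ^+ 2) by exact: bmeas_sqr.
by apply: bmeasB; [exact: bmu|apply: bmeas_sqr; exact: bmu].
Qed.

(** The first moment identity for [f ^+ 2] and the second one for [f] give the expected variance
    under the random measure: total variance [V n] minus the part [rho n * V n] due to the
    fluctuation of the mean. *)
Let var_cvg (f : S -> R) : bounded_continuous f ->
  \int[P n]_om (\int[mu n om]_z ((f z - \int[mu n om]_t f t) ^+ 2)) @[n --> \oo]
    --> (0 : R).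
Proof.
move=> cf; have bf := bbc cf; have [C C0 fC] := bmeas_ge0_bound bf.
have bf2 : bmeas (fun z : borel S => f z ^+ 2) by exact: bmeas_sqr.
pose a n := \int[mu0n n]_z f z.
pose V n := \int[mu0n n]_z ((f z - a n) ^+ 2).
have E n : \int[P n]_om (\int[mu n om]_z ((f z - \int[mu n om]_t f t) ^+ 2)) =
    (1 - rho n) * V n.
  have [E1 E2] := species_moments (smu n) bf.
  have bmf := bmu n bf.
  have bmf2 : bmeas (fun om => (\int[mu n om]_z f z) ^+ 2) by exact: bmeas_sqr.
  have ba := bmeas_cst (T := Om n) (a n ^+ 2).
  have E3 : \int[P n]_om ((\int[mu n om]_z f z) ^+ 2) = rho n * V n + a n ^+ 2.
    rewrite -E2 -/(a n).
    transitivity (\int[P n]_om ((\int[mu n om]_z f z - a n) ^+ 2 +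
        2 * a n * \int[mu n om]_z f z - a n ^+ 2)).
      by apply: eq_Rintegral => om _; ring.
    have bs : bmeas (fun om => (\int[mu n om]_z f z - a n) ^+ 2).
      by apply: bmeas_sqr; apply: bmeasB => //; exact: bmeas_cst.
    have bl := bmeasZ (2 * a n) bmf.
    rewrite (RexpB (P n) (bmeasD bs bl) ba) (RexpD (P n) bs bl) Rexp_cst.
    rewrite (RexpZ (P n) _ bmf) E1 -/(a n); ring.
  transitivity (\int[P n]_om (\int[mu n om]_z (f z ^+ 2) - (\int[mu n om]_z f z) ^+ 2)).
    by apply: eq_Rintegral => om _; exact: Rexp_var.
  rewrite (RexpB (P n) (bmu n bf2) bmf2) E3 mean_mu//.
  rewrite {2}/V /V Rexp_var// -/(a n); ring.
under eq_cvg do rewrite E.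
apply: (@squeeze_cvgr _ _ _ _ (fun=> 0) (fun n => (1 - rho n) * C ^+ 2)).
- apply: nearW => n; have /andP[V0 VC] := var_bound (mu0n n) bf fC.
  have /andP[_ r1] := rho01 n.
  have r0 : 0 <= 1 - rho n by rewrite subr_ge0 ltW.
  by apply/andP; split; [exact: mulr_ge0|exact: ler_wpM2l].
- exact: cvg_cst.
- rewrite -(mul0r (C ^+ 2)) -(subrr 1); apply: cvgM; last exact: cvg_cst.
  by apply: cvgB => //; exact: cvg_cst.
Qed.

Let mean_mu_cvg (f : S -> R) : bounded_continuous f ->
  \int[P n]_om (\int[mu n om]_z f z) @[n --> \oo] --> \int[mu0]_z f z.
Proof.
move=> cf; under eq_cvg do rewrite (mean_mu _ (bbc cf)).
exact: base_cvg.
Qed.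

Lemma weak_cvg_dist_full_ties :
  weak_cvg_dist P mu mu0 (fun z : borel S => (\d_z : probability (borel S) R)).
Proof.
move=> f cf F bF; have [C C0 fC] := bounded_continuous_bound cf.
have bf := bbc cf.
have cFf : bounded_continuous (fun z => F (f z)).
  have [cf' _] := cf; have [cF' [B FB]] := bF; split; last by exists B.
  by move=> z; apply: continuous_comp; [exact: cf'|exact: cF'].
have bFmu n : bmeas (fun om => F (\int[mu n om]_z f z)).
  split; last by have [_ [B FB]] := bF; exists B.
  apply: measurableT_comp; last by have [] := bmu n bf.
  by apply: continuous_measurable_fun; case: bF.
rewrite (_ : \int[mu0]_om _ = \int[mu0]_z F (f z)); last first.
  by apply: eq_Rintegral => z _; congr F; exact: Rexp_dirac.
apply: (mean_cvg0_cvg (Z' := fun n om => \int[mu n om]_z F (f z))) => //.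
- by move=> n; exact/bmu/bbc.
- apply: mean_cvg0_dominated (var_cvg cf).
  + by move=> n; apply: bmeasB => //; exact/bmu/bbc.
  + by move=> n; exact: bvar.
  (* The modulus is applied under the integral, between the mean [a] and [f z]; integrating in [z]
     turns the quadratic term into the variance under [mu n om]. *)
  + move=> e e0; have [K K0 KF] := quadratic_modulus C bF e0.
    exists K => // n om; set a := \int[mu n om]_t f t.
    have bd : bmeas (fun z : borel S => F a - F (f z)).
      by apply: bmeasB; [exact: bmeas_cst|exact: bbc cFf].
    have bq : bmeas (fun z : borel S => (f z - a) ^+ 2).
      by apply: bmeas_sqr; apply: bmeasB => //; exact: bmeas_cst.
    have -> : F a - \int[mu n om]_z F (f z) = \int[mu n om]_z (F a - F (f z)).
      by rewrite RexpB ?Rexp_cst//; [exact: bmeas_cst|exact: bbc cFf].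
    apply: le_trans (le_normr_Rintegral _ (bmeas_integrable _ bd)) _ => //.
    rewrite -(RexpZ _ _ bq) -[X in X + _](Rexp_cst (mu n om)) -RexpD; last 2 first.
    * exact: bmeas_cst.
    * exact: bmeasZ.
    apply: le_Rexp; first exact: bmeas_norm.
      by apply: bmeasD; [exact: bmeas_cst|exact: bmeasZ].
    move=> z; rewrite -(sqrrN (f z - a)) opprB; apply: KF.
    exact: Rexp_bound.
- exact: mean_mu_cvg.
Qed.

Lemma product_cvg_full_ties K (f : nat -> S -> R) :
  (forall i, unit_continuous (f i)) ->
  \int[P n]_om (\prod_(i < K) \int[mu n om]_z f i z) @[n --> \oo] -->
  \int[mu0]_z (\prod_(i < K) f i z).
Proof.
move=> cf; have bf i := bbc (unit_bc (cf i)).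
have cG k : bounded_continuous (fun z => \prod_(i < k) f i z).
  by apply: bounded_continuous_prod => i; exact: unit_bc.
have bprod n k : bmeas (fun om => \prod_(i < k) \int[mu n om]_z f i z).
  by apply: bmeas_prod => i; exact: bmu.
have bG n k : bmeas (fun om => \int[mu n om]_z (\prod_(i < k) f i z)).
  exact/bmu/bbc/cG.
apply: (mean_cvg0_cvg (Z' := fun n om => \int[mu n om]_z (\prod_(i < K) f i z))) => //;
  last exact: mean_mu_cvg.
elim: K => [|K IH].
  rewrite /mean_cvg0 (_ : (fun n => _) = fun=> 0); first exact: cvg_cst.
  apply/funext => n; rewrite -[RHS](Rexp_cst (P n)); apply: eq_Rintegral => om _.
  under eq_Rintegral do rewrite big_ord0.
  by rewrite big_ord0 Rexp_cst subrr normr0.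
pose D n om := \int[mu n om]_z (\prod_(i < K) f i z) * \int[mu n om]_z f K z -
  \int[mu n om]_z ((\prod_(i < K) f i z) * f K z).
have cGf : bounded_continuous (fun z => (\prod_(i < K) f i z) * f K z).
  by apply: bounded_continuousM => //; exact: unit_bc.
have bD n : bmeas (D n).
  by apply: bmeasB; [apply: bmeasM => //; exact: bmu|exact/bmu/bbc].
apply: (mean_cvg0D _ bD _ _ IH) => [n|n|n om|]; try exact: bmeasB.
- have -> : \int[mu n om]_z (\prod_(i < K.+1) f i z) =
      \int[mu n om]_z ((\prod_(i < K) f i z) * f K z).
    by apply: eq_Rintegral => z _; rewrite big_ord_recr.
  rewrite big_ord_recr/= /D; set A := \prod_(i < K) _.
  set B := \int[mu n om]_z (\prod_(i < K) f i z).
  set c := \int[mu n om]_z f K z; set G := \int[mu n om]_z (_ * _).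
  (* The first term is the induction hypothesis times a factor in [[0, 1]]. The second is minus a
     covariance under [mu n om], bounded below through the deviation of [f K] from its mean. *)
  have -> : A * c - G = (A - B) * c + (B * c - G) by ring.
  apply: le_trans (ler_normD _ _) _; rewrite normrM lerD2r ler_piMr//.
  have /andP[? ?] : 0 <= c <= 1 by apply: Rexp01; [exact: bf|have [] := cf K].
  by rewrite ger0_norm.
- apply: mean_cvg0_dominated (var_cvg (unit_bc (cf K))) => // [n|e e0].
    exact/bvar/unit_bc.
  exists e^-1; first by rewrite invr_ge0 ltW.
  move=> n om; rewrite /D; set c := \int[mu n om]_z f K z.
  have bGK := bbc (cG K); have bGf := bbc cGf.
  have bd : bmeas (fun z : borel S => (\prod_(i < K) f i z) * (c - f K z)).
    by apply: bmeasM => //; apply: bmeasB => //; exact: bmeas_cst.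
  have bq : bmeas (fun z : borel S => (f K z - c) ^+ 2).
    by apply: bmeas_sqr; apply: bmeasB => //; exact: bmeas_cst.
  have -> : \int[mu n om]_z (\prod_(i < K) f i z) * c -
      \int[mu n om]_z (\prod_(i < K) f i z * f K z) =
      \int[mu n om]_z ((\prod_(i < K) f i z) * (c - f K z)).
    rewrite mulrC -(RexpZ _ _ bGK) -RexpB//; last exact: bmeasZ.
    by apply: eq_Rintegral => z _; ring.
  apply: le_trans (le_normr_Rintegral _ (bmeas_integrable _ bd)) _ => //.
  rewrite -(RexpZ _ _ bq) -[X in X + _](Rexp_cst (mu n om)) -RexpD; last 2 first.
  * exact: bmeas_cst.
  * exact: bmeasZ.
  apply: le_Rexp; first exact: bmeas_norm.
    by apply: bmeasD; [exact: bmeas_cst|exact: bmeasZ].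
  move=> z; apply: le_trans (normr_le_sqr _ e0).
  rewrite normrM distrC ler_piMl// normr_prod prodr_ile1// => i _.
  by have [_ /(_ z)/andP[? ?]] := cf i; rewrite normr_ge0/= ger0_norm.
Qed.

End full_ties.
End SpeciesLimits.

Lemma dense_sequence {R : realType} {S : completePseudoMetricType R} :
  polish S ->
  exists q : nat -> S, forall (x : S) (e : R), 0 < e -> exists m, ball x e (q m).
Proof.
move=> [_ [D [/pfcard_geP cD dD]]].
have near_D (x : S) (e : R) : 0 < e -> exists2 z, D z & ball x e z.
  (* The axioms of [ball] do not make it open, so density is applied to its interior. *)
  move=> e0; have [z [/interior_subset xz Dz]] : ((ball x e)^° `&` D) !=set0.
    by apply: dD; [exists x; exact: nbhsx_ballx|exact: open_interior].
  by exists z.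
case: cD => [D0|/unsquash q].
  by have [z] := near_D point 1 ltr01; rewrite D0.
exists q => x e /(near_D x)[z Dz xz].
by have [m _ qm] := 'surj_q Dz; exists m; rewrite qm.
Qed.

Unset Implicit Arguments.

Theorem theorem8 (R : realType) (S : completePseudoMetricType R)
  (mu0 : probability (borel S) R) (mu0n : nat -> probability (borel S) R)
  (rho : nat -> R)
  (dO : nat -> measure_display) (Om : forall n, measurableType (dO n))
  (P : forall n, probability (Om n) R)
  (mu : forall n, Om n -> probability (borel S) R)
  (x : forall n, nat -> Om n -> borel S) :
  polish S ->
  diffuse mu0 ->
  (forall n, diffuse (mu0n n)) ->
  weak_cvg mu0n mu0 ->
  (forall n, 0 < rho n < 1) ->
  (forall n, species_sampling (P n) (mu0n n) (rho n) (mu n)) ->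
  (forall n, cond_iid (P n) (mu n) (x n)) ->
  (* (i) *)
  (rho n @[n --> \oo] --> (0 : R) ->
     weak_cvg_dist P mu mu0 (fun _ : borel S => mu0) /\
     (forall (d' : measure_display) (Om' : measurableType d')
             (Q : probability Om' R) (y : nat -> Om' -> borel S),
        iid Q mu0 y ->
        @cvg_dist R {ptws nat -> S} dO Om P
          (fun n om => (fun i => x n i om) : {ptws nat -> S})
          d' Om' Q (fun om => (fun i => y i om) : {ptws nat -> S}))) /\
  (* (ii) *)
  (rho n @[n --> \oo] --> (1 : R) ->
     weak_cvg_dist P mu mu0 (fun z : borel S => (\d_z : probability (borel S) R)) /\
     @cvg_dist R {ptws nat -> S} dO Om P
       (fun n om => (fun i => x n i om) : {ptws nat -> S})
       _ (borel S) mu0 (fun z : borel S => (fun _ : nat => z) : {ptws nat -> S})).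
Proof.
move=> pS _ _ base_cvg rho01 smu ciid.
have [q q_dense] := dense_sequence pS.
have mx n i : measurable_fun [set: Om n] (x n i) by have [] := ciid n.
have cont f i : (forall i : nat, unit_continuous (f i)) -> bmeas (f i : borel S -> R).
  move=> cf; apply: bmeas_borel_continuous; have [cfi f01] := cf i.
  by split => //; exists 1 => z; have /andP[? ?] := f01 z; rewrite ger0_norm.
have mom n K (f : nat -> S -> R) : (forall i, unit_continuous (f i)) ->
    \int[P n]_om cylp K f (fun i => x n i om) =
    \int[P n]_om (\prod_(i < K) \int[mu n om]_z f i z).
  move=> cf; apply: (cond_iid_product (proj1 (smu n)) (ciid n)) => i.
  exact: cont.
split=> rho_lim; split.
- exact: weak_cvg_dist_vanishing_ties base_cvg rho01 smu rho_lim.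
- move=> d' Om' Q y iy.
  apply: (cvg_dist_product_moments q_dense mx (proj1 iy)) => K f cf.
  under eq_cvg do rewrite mom//.
  rewrite (_ : Rintegral _ _ _ = \prod_(i < K) \int[mu0]_z f i z); last first.
    by apply: (iid_product iy) => i; exact: cont.
  exact: product_cvg_vanishing_ties base_cvg rho01 smu rho_lim K f cf.
- exact: weak_cvg_dist_full_ties base_cvg rho01 smu rho_lim.
(* The constant limit sequence lives on [(borel S, mu0)] itself, every coordinate being the
   identity, so its product moments are the [mu0]-integrals of the products of the [f i]. *)
- apply: (cvg_dist_product_moments q_dense mx
    (y := fun (_ : nat) (z : borel S) => z)) => [_|K f cf].
    exact: measurable_id.
  under eq_cvg do rewrite mom//.
  exact: product_cvg_full_ties base_cvg rho01 smu rho_lim K f cf.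
Qed.
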